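(* Let $u,v\in S_n$ be permutations with separated descents at position $k$, i.e. $\mathrm{maxdes}(u)\le k\le \mathrm{mindes}(v)$. For every $w\in S_n$, the coefficient $c_{u,v}^{w}(t,y)$ of $\mathfrak{G}_w(x,t)$ in the expansion of $\mathfrak{G}_u(x,y)\cdot\mathfrak{G}_v(x,t)$ in the double Grothendieck polynomials $\mathfrak{G}_{w'}(x,t)$ is $$c_{u,v}^{w}(t,y)=\sum_{\pi\in \mathrm{PP}(u,v,w)}\mathrm{wt}(\pi),$$ where $\mathrm{PP}(u,v,w)$ is the set of (Grothendieck) pipe puzzles for $u,v,w$ and $\mathrm{wt}$ is their weight.
   Context: Let $\beta$, $x_1,x_2,\ldots$, $t_1,t_2,\ldots$, $y_1,y_2,\ldots$ be commuting indeterminates and write $a\ominus b=\dfrac{a-b}{1+\beta b}$. Let $S_n$ be the group of permutations of $\{1,\ldots,n\}$, $S_\infty=\bigcup_n S_n$, $s_i=(i,i+1)$; $ws_i$ is obtained from $w$ by swapping $w(i)$ and $w(i+1)$. Double Grothendieck polynomials $\mathfrak{G}_w(x,t)$, $w\in S_\infty$, are determined by $\mathfrak{G}_{n\cdots 21}(x,t)=\prod_{i+j\le n}(x_i\ominus t_j)$ for all $n$, and $\pi_i\mathfrak{G}_w(x,t)=\mathfrak{G}_{ws_i}(x,t)$ whenever $w(i)>w(i+1)$, where $\pi_i f=\dfrac{(1+\beta x_{i+1})f-(1+\beta x_i)f|_{x_i\leftrightarrow x_{i+1}}}{x_i-x_{i+1}}$. $\mathfrak{G}_u(x,y)$ is $\mathfrak{G}_u(x,t)$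 with $t$ replaced by $y$. The coefficients are defined by $$\mathfrak{G}_u(x,y)\cdot\mathfrak{G}_v(x,t)=\sum_{w\in S_\infty}c_{u,v}^{w}(t,y)\,\mathfrak{G}_w(x,t),$$ where the coefficients do not involve the $x$ variables. $\mathrm{maxdes}(u)=\max\{i: u(i)>u(i+1)\}$, $\mathrm{mindes}(v)=\min\{i: v(i)>v(i+1)\}$, with $\mathrm{maxdes}(\mathrm{id})=0$, $\mathrm{mindes}(\mathrm{id})=+\infty$. Boundary labels. Consider an $n\times n$ grid of unit cells, with position $(i,j)$ in matrix coordinates (row $i$ from the top, column $j$ from the left). Its boundary edges are labeled as follows: all left boundary edges are labeled $0$; the right boundary edge of row $i$ is labeled $\kappa_u^i$, where $\kappa_u^i=u^{-1}(i)$ if $u^{-1}(i)\le k$ and $\kappa_u^i=0$ otherwise; the top boundary edge of column $i$ is labeled $\theta_v^i$, where $\theta_v^i=v^{-1}(i)$ if $v^{-1}(i)>k$ and $\theta_v^i=0$ otherwise; the bottom boundary edge of column $i$ is labeled $\eta_w^i=w^{-1}(i)$. Tiles. Each cell is filled with one of the following tiles, carrying pipe segments joining midpoints of sides: the empty tile (no pipe); the crossing tile (one horizontal pipe left–right and one vertical pipe top–bottom, crossing); the F-elbow (one pipe joining the bottom and right sides); the J-elbow (one pipe joining the top and left sides); the vertical tile (one pipe top–bottom); the horizontal tile (one pipe left–right); the bumping tile (two non-crossing pipes, a ''northwest'' one joining the top and left sides and a ''southeast'' one joining the bottom and right sides). The segments must match across interior edges. A boundary edge is met by a pipe if and only if its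 label is nonzero. Thus pipes enter through the right boundary edges and the top boundary edges with nonzero label, each pipe inherits the label of the boundary edge where it enters (it is ''from the right side'' or ''from the top side'' accordingly), and each pipe must end on the bottom boundary in the column whose bottom label equals the label of the pipe. A pipe puzzle for $u,v,w$ is such a tiling satisfying: (a) in every crossing tile the horizontal pipe has a smaller label than the vertical pipe; (b) in every bumping tile whose two pipes are from the same side, the northwest pipe has the larger label; (c) in every bumping tile whose two pipes are from different sides, the northwest pipe is the one from the right side. $\mathrm{PP}(u,v,w)$ is the set of these. Weight. $\mathrm{wt}(\pi)$ is the product over all positions $(i,j)$ of the following factors: an empty tile contributes $t_j\ominus y_i$; a J-elbow tile whose pipe is from the right side contributes $1+\beta(t_j\ominus y_i)$; an F-elbow tile whose pipe is from the top side contributes $1+\beta(t_j\ominus y_i)$; a bumping tile whose two pipes are from the same side contributes $\beta$; a bumping tile whose two pipes are from different sides contributes $\beta(1+\beta(t_j\ominus y_i))$; every other tile contributes $1$. *)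

(* Defs.v *)
From HB Require Import structures.
From mathcomp Require Import all_boot all_order all_algebra all_fingroup.
From mathcomp Require Import finmap.
From mathcomp Require Import monalg.

Set Implicit Arguments.
Unset Strict Implicit.
Unset Printing Implicit Defensive.

Import GRing.Theory.
Local Open Scope ring_scope.

(* ------------------------------------------------------------------------ *)
(* Polynomials in possibly infinitely many variables: {malg R[{cmonom I}]}  *)
(* is an integral domain when R is one and I is countable.  The proof maps  *)
(* the variable i to 'X^(N ^ pickle i), for N large (Kronecker).            *)
(* ------------------------------------------------------------------------ *)

Section Kronecker.
Variables (I : countType) (R : idomainType) (N D : nat).
Implicit Types (m : {cmonom I}) (p q : {malg R[{cmonom I}]}).

Definition digit m (k : nat) : nat := if @pickle_inv I k is Some i then m i else 0%N.

Definition kron m : nat := (\sum_(k < D) digit m k * N ^ k)%N.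

Definition kronX m : {poly R} := 'X^(kron m).

Lemma kronX_mmorphism : mmorphism kronX.
Proof.
split=> [m1 m2|]; rewrite /kronX.
  rewrite -exprD /kron -big_split /=; congr ('X^_); apply: eq_bigr => k _.
  rewrite -mulnDl /digit; case: pickle_inv => //= i; congr (_ * _)%N; exact: cmM.
rewrite [kron _]big1 ?expr0 // => k _; rewrite /digit.
by case: pickle_inv => //= i; rewrite cm1.
Qed.

HB.instance Definition _ := isMultiplicative.Build _ _ kronX kronX_mmorphism.

Definition kronP p : {poly R} := mmap (@polyC R) kronX p.

Lemma kronPM p q : kronP (p * q) = kronP p * kronP q.
Proof. exact: (@rmorphM _ _ (mmap (@polyC R) kronX)). Qed.

Lemma kronP1 : kronP 1 = 1.
Proof. exact: (@rmorph1 _ _ (mmap (@polyC R) kronX)). Qed.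

Definition small m := forall i, (choice.pickle i < D)%N && (m i < N)%N || (m i == 0%N).

Lemma kron_inj m1 m2 : (0 < N)%N -> small m1 -> small m2 -> kron m1 = kron m2 -> m1 = m2.
Proof.
move=> N0 s1 s2 e; apply/eqP/cmP => i.
have digitE m : digit m (choice.pickle i) = m i by rewrite /digit pickleK_inv.
have sdigit m k : small m -> (digit m k < N)%N.
  by move=> s; rewrite /digit; case: pickle_inv => // j; case/orP: (s j) => [/andP[]|/eqP->].
have main d (f g : nat -> nat) : (forall k, f k < N)%N -> (forall k, g k < N)%N ->
    (\sum_(k < d) f k * N ^ k = \sum_(k < d) g k * N ^ k)%N -> forall k, (k < d)%N -> f k = g k.
  elim: d f g => // d IH f g sf sg; rewrite !big_ord_recl !expn0 !muln1.
  have shift (h : nat -> nat) : (\sum_(i < d) h (bump 0 i) * N ^ (bump 0 i) =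
     (\sum_(i < d) h i.+1 * N ^ i) * N)%N.
    by rewrite big_distrl; apply: eq_bigr => j _; rewrite /= expnSr mulnA.
  rewrite /= !shift => ee [|k] lk.
    by have := congr1 (modn^~ N) ee; rewrite /= ![(_ + _ * N)%N]addnC !modnMDl !modn_small.
  have := congr1 (divn^~ N) ee; rewrite /= ![(_ + _ * N)%N]addnC !divnMDl //.
  rewrite !divn_small // !addn0 => e'.
  exact: (IH (f \o succn) (g \o succn) (fun _ => sf _) (fun _ => sg _) e' k lk).
have [lt|ge] := ltnP (choice.pickle i) D.
  by rewrite -(digitE m1) -(digitE m2); apply: (main D) => // k; apply: sdigit.
by case/orP: (s1 i); case/orP: (s2 i); rewrite ?[(_ < D)%N]ltnNge ?ge // => /eqP-> /eqP->.
Qed.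

Lemma kronP_coef p m : (0 < N)%N -> small m -> (forall m', m' \in msupp p -> small m') ->
  (kronP p)`_(kron m) = p@_m.
Proof.
move=> N0 sm sp; rewrite /kronP mmapE coef_sum.
have E m' : m' \in msupp p -> ((p@_m')%:P * kronX m')`_(kron m) = if m' == m then p@_m' else 0.
  move=> /sp s'; rewrite coefCM coefXn; case: (eqVneq m' m) => [->|ne]; first by rewrite eqxx mulr1.
  case: eqP => [e|_]; last by rewrite mulr0.
  by case/eqP: ne; apply: kron_inj.
rewrite big_seq (eq_bigr _ E) -big_seq.
have [mp|mp] := boolP (m \in msupp p).
  rewrite (big_fsetD1 m) //= eqxx big_seq big1 ?addr0 // => m'.
  by rewrite in_fsetD1 => /andP[/negPf->].
rewrite mcoeff_outdom // big_seq big1 // => m' m'p; case: eqP => // e.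
by rewrite -e m'p in mp.
Qed.

End Kronecker.

Section MalgDomain.
Variables (I : countType) (R : idomainType).
Local Notation mon := {cmonom I}.
Implicit Types (p q : {malg R[mon]}).

Lemma kron_bound (s : seq mon) :
  exists N D, (0 < N)%N /\ forall m, m \in s -> small N D m.
Proof.
exists (\max_(m <- s) \max_(i <- finsupp m) (m i).+1).+1.
exists (\max_(m <- s) \max_(i <- finsupp m) (choice.pickle i).+1)%N; split=> // m ms i.
have [is_|is_] := boolP (i \in finsupp m); last by rewrite cmE_eq0 is_ orbT.
apply/orP; left; apply/andP; split.
  apply: leq_trans (leq_bigmax_seq _ ms isT); exact: (leq_bigmax_seq _ is_ isT).
rewrite ltnS; apply: ltnW; apply: leq_trans (@leq_bigmax_seq _ s xpredT (fun m : mon => (\max_(i <- finsupp m) (m i).+1)%N) m ms isT).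
exact: (@leq_bigmax_seq _ _ xpredT (fun i => (m i).+1) i is_ isT).
Qed.

Definition malg_unit : pred {malg R[mon]} :=
  fun p => (p == (p@_mone)%:MP) && (p@_mone \in GRing.unit).

Definition malg_inv p := if malg_unit p then (p@_mone)^-1%:MP else p.

Fact malg_mulVp : {in malg_unit, left_inverse 1 malg_inv *%R}.
Proof.
move=> p Up; have Up' : malg_unit p := Up; rewrite /malg_inv Up'.
case/andP: Up' => /eqP e U; rewrite [X in _ * X]e -mpolyCM (mulVr U) mpolyC1E. reflexivity.
Qed.

Fact malg_intro_unit p q : q * p = 1 -> p \in malg_unit.
Proof.
move=> qp1; apply/andP; split; last first.
  have c1: q@_mone * p@_mone = 1 by rewrite -(rmorphM (mcoeff mone)) qp1 rmorph1.
  by apply/unitrP; exists q@_mone; split; [exact: c1 | rewrite mulrC c1].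
have [N [D [N0 sm]]] := kron_bound (mone :: msupp p).
have s1 : small N D (mone : mon) by apply: sm; rewrite inE eqxx.
have sp m : m \in msupp p -> small N D m by move=> mp; apply: sm; rewrite inE mp orbT.
have: kronP N D p \is a GRing.unit.
  have kqp : kronP N D q * kronP N D p = 1 by rewrite -kronPM qp1 kronP1.
  by apply/unitrP; exists (kronP N D q); split; [exact: kqp | rewrite mulrC kqp].
rewrite poly_unitE => /andP[/size_poly1P[c _ pc] _].
apply/eqP/malgP => m; rewrite mcoeffC; case: eqVneq => [->//|ne].
rewrite mulr0n; have [mp|mp] := boolP (m \in msupp p); last by rewrite mcoeff_outdom.
rewrite -(kronP_coef N0 (sp _ mp) sp) pc coefC; case: eqP => // k0.
case/eqP: ne; apply: (kron_inj N0 (sp _ mp) s1); rewrite k0.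
rewrite /kron big1 // => k _; rewrite /digit; case: pickle_inv => //= i; by rewrite cm1.
Qed.

Fact malg_inv_out : {in [predC malg_unit], malg_inv =1 id}.
Proof. by move=> p /negPf Up; rewrite /malg_inv [malg_unit p]Up. Qed.

Fact malg_idomain : GRing.integral_domain_axiom {malg R[mon]}.
Proof.
move=> p q pq0; have [N [D [N0 sm]]] := kron_bound (msupp p ++ msupp q).
have nz r : (forall m, m \in msupp r -> small N D m) -> kronP N D r = 0 -> r == 0.
  move=> sr r0; apply/eqP/malgP => m; rewrite mcoeff0.
  have [mr|mr] := boolP (m \in msupp r); last by rewrite mcoeff_outdom.
  by rewrite -(kronP_coef N0 (sr _ mr) sr) r0 coef0.
have: kronP N D p * kronP N D q == 0 by rewrite -kronPM pq0 /kronP raddf0.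
rewrite mulf_eq0 => /orP[] /eqP e; apply/orP; [left|right]; apply: nz e => m mr;
  by apply: sm; rewrite mem_cat mr ?orbT.
Qed.

HB.instance Definition _ := GRing.ComNzRing_hasMulInverse.Build {malg R[mon]}
  malg_mulVp malg_intro_unit malg_inv_out.
HB.instance Definition _ := GRing.ComUnitRing_isIntegral.Build {malg R[mon]}
  malg_idomain.

End MalgDomain.

(* ------------------------------------------------------------------------ *)
(* Sinf is S_oo.  All indices (positions, values, variables, rows, columns) *)
(* are 0-based: the index i stands for the i.+1 of the usual notation.      *)
(* ------------------------------------------------------------------------ *)

Definition fsbij (f : {fsfun nat -> nat of x => x}) : bool :=
  [fset f i | i in finsupp f]%fset == finsupp f.

Lemma fsbijP (f : {fsfun nat -> nat of x => x}) : reflect (bijective f) (fsbij f).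
Proof.
apply: (iffP eqP) => [fim | bf]; last first.
  have fi := bij_inj bf; apply/eqP; rewrite eqEfcard card_imfset // leqnn andbT.
  apply/fsubsetP => j /imfsetP [i /= fi_i ->]; rewrite mem_finsupp.
  by apply/eqP => /fi e; move: fi_i; rewrite mem_finsupp e eqxx.
have fst_ i : i \in finsupp f -> f i \in finsupp f.
  by move=> i_; rewrite -[X in _ \in X]fim; apply: in_imfset.
have fi : injective f.
  have fi : {in finsupp f &, injective f} by apply/card_in_imfsetP; rewrite fim.
  move=> i j e; have [ii|ii] := boolP (i \in finsupp f); have [jj|jj] := boolP (j \in finsupp f).
  - exact: fi.
  - by move: (fst_ _ ii); rewrite e (fsfun_dflt jj) (negPf jj).
  - by move: (fst_ _ jj); rewrite -e (fsfun_dflt ii) (negPf ii).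
  - by rewrite -(fsfun_dflt ii) e fsfun_dflt.
have surj j : exists i, f i == j.
  have [jj|jj] := boolP (j \in finsupp f); last by exists j; rewrite fsfun_dflt.
  by move: (jj); rewrite -{1}fim => /imfsetP [i _ ->]; exists i.
exists (fun j => xchoose (surj j)) => [i|j]; last exact/eqP/(xchooseP (surj j)).
by apply: fi; apply/eqP/(xchooseP (surj (f i))).
Qed.

Record Sinf := MkSinf { sinf_fun :> {fsfun nat -> nat of x => x}; _ : fsbij sinf_fun }.

HB.instance Definition _ := [isSub for sinf_fun].
HB.instance Definition _ := [Choice of Sinf by <:].

Lemma sinf_bij (w : Sinf) : bijective w.
Proof. by case: w => f fb; apply/fsbijP. Qed.

Section Embedding.
Variables (n : nat) (u : 'S_n).

Definition embed_fun : {fsfun nat -> nat of x => x} :=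
  [fsfun i in [fset j in iota 0 n]%fset => if insub i is Some o then val (u o) else i].

Lemma embed_funE i : embed_fun i = if insub i is Some o then val (u o) else i.
Proof.
rewrite fsfunE; case: ifP => // /negP; case: insubP => //= o lt _ [].
by apply/imfsetP; exists i; rewrite //= mem_iota.
Qed.

Fact embed_fun_bij : fsbij embed_fun.
Proof.
apply/fsbijP.
have K (p q : 'S_n) i : (forall x, q (p x) = x) ->
   (if insub (if insub i is Some o then val (p o) else i) is Some o then val (q o)
     else (if insub i is Some o then val (p o) else i)) = i.
  by move=> qp; case: (insubP 'I_n i) => [o _ <-|/negPf h]; rewrite ?valK ?qp // insubF.
exists (fun i : nat => if insub i is Some o then val ((u^-1)%g o) else i) => i.
  by rewrite embed_funE K // => x; rewrite permK.
by rewrite embed_funE K // => x; rewrite permKV.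
Qed.

Definition embed : Sinf := MkSinf embed_fun_bij.

Lemma embedE (i : 'I_n) : embed i = u i.
Proof. by rewrite /embed /= embed_funE valK. Qed.

Lemma embed_out i : (n <= i)%N -> embed i = i.
Proof. by move=> ni; rewrite /embed /= embed_funE insubF // ltnNge ni. Qed.

End Embedding.

Definition adj (i j : nat) : nat :=
  if j == i then i.+1 else if j == i.+1 then i else j.

Lemma adjK i : involutive (adj i).
Proof.
move=> j; rewrite /adj; have [->|ji] := eqVneq j i.
  by rewrite -[i.+1 == i]/(i.+1 == i) eqn_leq ltnn eqxx.
by have [->|ji'] := eqVneq j i.+1; rewrite ?eqxx // (negPf ji) (negPf ji').
Qed.

Section RightMul.
Variables (w : Sinf) (i : nat).

Definition mulsr_fun : {fsfun nat -> nat of x => x} :=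
  [fsfun j in (i |` (i.+1 |` finsupp w))%fset => w (adj i j)].

Lemma mulsr_funE j : mulsr_fun j = w (adj i j).
Proof.
rewrite fsfunE; case: ifP => //; rewrite !in_fset1U /adj.
case: eqVneq => //= _; case: eqVneq => //= _.
by move=> jw; rewrite fsfun_dflt // jw.
Qed.

Fact mulsr_bij : fsbij mulsr_fun.
Proof.
apply/fsbijP; apply: (@eq_bij _ _ (w \o adj i)); last by move=> j; rewrite mulsr_funE.
by apply: bij_comp (sinf_bij w) _; exists (adj i); apply: adjK.
Qed.

(* w s_i *)
Definition mulsr : Sinf := MkSinf mulsr_bij.

End RightMul.

Definition longest (n : nat) : 'S_n := perm (@rev_ord_inj n).

Section Grothendieck.
Variables (F : fieldType) (b : F).

Definition ominus (a c : F) : F := (a - c) / (1 + b * c).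

Local Notation polyx := {malg F[{cmonom nat}]}.

Definition xvar (i : nat) : polyx := << ucm i >>.

(* x_i \ominus a; its denominator 1 + b a is a scalar *)
Definition xominus (i : nat) (a : F) : polyx := (1 + b * a)^-1 *: (xvar i - a%:MP).

Definition xsubst (g : nat -> polyx) (f : polyx) : polyx :=
  mmap (@malgC _ F) (fun m : {cmonom nat} => \prod_(j <- finsupp m) g j ^+ m j) f.

Definition xswap (i : nat) (f : polyx) : polyx := xsubst (fun j => xvar (adj i j)) f.

(* g = pi_i f.  The quotient defining pi_i f is written without denominator: *)
(* polyx is an integral domain, so g is determined by f.                     *)
Definition is_demazure (i : nat) (f g : polyx) : Prop :=
  (xvar i - xvar i.+1) * g =
  (1 + b *: xvar i.+1) * f - (1 + b *: xvar i) * xswap i f.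

(* The two conditions determine G w as the double Grothendieck polynomial   *)
(* of w in x and a: every element of S_n is reached from longest n.         *)
Record double_grothendieck (a : nat -> F) (G : Sinf -> polyx) : Prop := {
  groth_longest : forall n : nat,
    G (embed (longest n)) =
    \prod_(i < n) \prod_(j < n | (i.+1 + j.+1 <= n)%N) xominus i (a j);
  groth_demazure : forall (w : Sinf) (i : nat),
    (w i.+1 < w i)%N -> is_demazure i (G w) (G (mulsr w i))
}.

End Grothendieck.

Section Descents.
Variables (n : nat) (u : 'S_n).

(* 1-based positions, in increasing order *)
Definition descents : seq nat :=
  [seq i.+1 | i <- iota 0 n & (embed u i.+1 < embed u i)%N].

Definition maxdes : nat := (\max_(d <- descents) d)%N.

(* None stands for +oo *)
Definition mindes : option nat := ohead descents.

End Descents.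

Definition leq_oo (k : nat) (d : option nat) : bool :=
  if d is Some d' then (k <= d')%N else true.

(* A pipe remembers the side from which it enters (true: right side, false: *)
(* top side) and, 0-based, the nonzero label of its entering edge; the      *)
(* absence of a pipe, that is the label 0, is None.                         *)
Notation pipe n := (bool * 'I_n)%type.

Section Cells.
Variable n : nat.
Implicit Types p : pipe n.

Definition from_right p : bool := p.1.
Definition label p : 'I_n := p.2.

(* A tile together with the pipes its segments belong to. *)
Inductive cell : predArgType :=
  | Empty
  | Cross of pipe n & pipe n (* horizontal, vertical *)
  | FElbow of pipe n
  | JElbow of pipe n
  | Vertical of pipe n
  | Horizontal of pipe n
  | Bump of pipe n & pipe n (* northwest, southeast *).

Local Notation cell_sum :=
  (unit + (pipe n * pipe n) + pipe n + pipe n + pipe n + pipe n + (pipe n * pipe n))%type.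

Definition cell_code (c : cell) : cell_sum :=
  match c with
  | Empty => inl (inl (inl (inl (inl (inl tt)))))
  | Cross h v => inl (inl (inl (inl (inl (inr (h, v))))))
  | FElbow p => inl (inl (inl (inl (inr p))))
  | JElbow p => inl (inl (inl (inr p)))
  | Vertical p => inl (inl (inr p))
  | Horizontal p => inl (inr p)
  | Bump p q => inr (p, q)
  end.

Definition cell_decode (s : cell_sum) : cell :=
  match s with
  | inl (inl (inl (inl (inl (inl _))))) => Empty
  | inl (inl (inl (inl (inl (inr (h, v)))))) => Cross h v
  | inl (inl (inl (inl (inr p)))) => FElbow p
  | inl (inl (inl (inr p))) => JElbow p
  | inl (inl (inr p)) => Vertical p
  | inl (inr p) => Horizontal p
  | inr (p, q) => Bump p q
  end.

Lemma cell_codeK : cancel cell_code cell_decode.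
Proof. by case. Qed.

HB.instance Definition _ := Finite.copy cell (can_type cell_codeK).

Definition top_edge (c : cell) : option (pipe n) :=
  match c with
  | Cross _ p | JElbow p | Vertical p | Bump p _ => Some p
  | Empty | FElbow _ | Horizontal _ => None
  end.

Definition left_edge (c : cell) : option (pipe n) :=
  match c with
  | Cross p _ | JElbow p | Horizontal p | Bump p _ => Some p
  | Empty | FElbow _ | Vertical _ => None
  end.

Definition bottom_edge (c : cell) : option (pipe n) :=
  match c with
  | Cross _ p | FElbow p | Vertical p | Bump _ p => Some p
  | Empty | JElbow _ | Horizontal _ => None
  end.

Definition right_edge (c : cell) : option (pipe n) :=
  match c with
  | Cross p _ | FElbow p | Horizontal p | Bump _ p => Some p
  | Empty | JElbow _ | Vertical _ => None
  end.

Definition cell_ok (c : cell) : bool :=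
  match c with
  | Cross h v => (label h < label v)%N
  | Bump nw se =>
      if from_right nw == from_right se then (label se < label nw)%N
      else from_right nw
  | _ => true
  end.

(* o is t_j \ominus y_i for a cell in position (i, j) *)
Definition cell_weight (F : fieldType) (b o : F) (c : cell) : F :=
  match c with
  | Empty => o
  | JElbow p => if from_right p then 1 + b * o else 1
  | FElbow p => if from_right p then 1 else 1 + b * o
  | Bump nw se => if from_right nw == from_right se then b else b * (1 + b * o)
  | Cross _ _ | Vertical _ | Horizontal _ => 1
  end.

End Cells.

Section Puzzles.
Variables (n k : nat) (u v w : 'S_n).
Local Notation tiling := {ffun 'I_n * 'I_n -> cell n}.

(* kappa_u *)
Definition right_label (i : 'I_n) : option (pipe n) :=
  let a := (u^-1)%g i in if (a.+1 <= k)%N then Some (true, a) else None.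

(* theta_v *)
Definition top_label (j : 'I_n) : option (pipe n) :=
  let a := (v^-1)%g j in if (k < a.+1)%N then Some (false, a) else None.

Definition interior_ok (T : tiling) : bool :=
  [forall i : 'I_n, forall j : 'I_n, forall l : 'I_n,
     (l == i.+1 :> nat) ==>
       (bottom_edge (T (i, j)) == top_edge (T (l, j))) &&
       (right_edge (T (j, i)) == left_edge (T (j, l)))].

Definition boundary_ok (T : tiling) : bool :=
  [forall i : 'I_n, forall j : 'I_n,
     [&& (j == 0%N :> nat) ==> (left_edge (T (i, j)) == None),
         (j.+1 == n) ==> (right_edge (T (i, j)) == right_label i),
         (i == 0%N :> nat) ==> (top_edge (T (i, j)) == top_label j)
       & (i.+1 == n) ==>
           (omap (@label n) (bottom_edge (T (i, j))) == Some ((w^-1)%g j))]].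

Definition pipe_puzzles : {set tiling} :=
  [set T | [&& interior_ok T, boundary_ok T & [forall ij, cell_ok (T ij)]]].

End Puzzles.

Definition puzzle_weight (F : fieldType) (b : F) (t y : nat -> F) (n : nat)
    (T : {ffun 'I_n * 'I_n -> cell n}) : F :=
  \prod_(i < n) \prod_(j < n) cell_weight b (ominus b (t j) (y i)) (T (i, j)).

(* The field Q(beta, t, y) of rational functions. *)
Notation param := (unit + nat + nat)%type.
Notation coeff := {fraction {malg int[{cmonom param}]}}.

Definition indet (p : param) : coeff := FracField.tofrac << ucm p >>.

Definition beta : coeff := indet (inl (inl tt)).
Definition tvar (i : nat) : coeff := indet (inl (inr i)).
Definition yvar (i : nat) : coeff := indet (inr i).

(* Main.v *)
(* Write t' for t with t_i and t_(i+1) exchanged.  The left divided difference in t expresses G_v(x,t)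
   through G_v(x,t') and G_(s_i v)(x,t').  Since the coefficient of G_w(x,t) in f is obtained from f by
   divided differences in t along a reduced word of w, followed by x = t, this gives for s_i w > w the
   coefficient c_(u,v)^(s_i w) through c_(u,v)^w and c_(u,s_i v)^w at t and t'.  The weighted count of
   puzzles satisfies the same recurrence: move an R-matrix, from top to bottom, through the columns i
   and i+1 by the Yang-Baxter equation.  This reduces to w = 1, where the coefficient is 0 unless v = 1,
   in which case it is G_u(t,y).  The left divided difference in y, matched by the Yang-Baxter equation
   for two adjacent rows, then reduces to the longest u with maxdes u <= k.  For it G_u is a product
   and there is exactly one puzzle. *)

Require Import Defs.
From HB Require Import structures.
From mathcomp Require Import all_boot all_order all_algebra all_fingroup.
From mathcomp Require Import finmap.
From mathcomp Require Import monalg.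
From mathcomp Require Import ring zify.

Set Implicit Arguments.
Unset Strict Implicit.
Unset Printing Implicit Defensive.

Import GRing.Theory.
Local Open Scope ring_scope.

(** * Transfer operators and the Yang-Baxter equation *)

(** The recurrence in t changes the parameters, the family and v at once, so the induction on w
    quantifies over all of them: over any field, for distinct parameters a_j with 1 + b a_j nonzero
    ([good]). A family for the exchanged parameters is built from the given one by solving the left
    divided difference for its swapped term ([left_family]). Separatedness survives: if the value
    i+1 precedes the value i in v, then i stands after position k, since v increases on the first k
    positions. Hence s_i v is again separated, and column i carries a pipe at the top. At the
    boundary the off-diagonal part of the R-matrix either vanishes or produces exactly the term with
    s_i v (top), s_i w (bottom) or s_i u (right); on the empty left boundary the R-matrix is a
    scalar. One R-matrix serves the whole grid because a passage from t to t ⊖ y only rescales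
    it. *)

Section Transfer.
Variables (F : fieldType) (b : F) (n : nat).
Local Notation E := (option (pipe n)).
Implicit Types (o : F) (p q : pipe n) (e : E).

(* On the pipes of a puzzle this is the order of labels, since labels up to k come from the right *)
(* side and the others from the top side; ordering sides first makes the local identities below *)
(* valid for arbitrary pipes. *)
Definition pipe_lt p q : bool :=
  if from_right p == from_right q then (label p < label q)%N else from_right p.

Lemma pipe_lt_asym p q : pipe_lt p q -> pipe_lt q p = false.
Proof.
case: p q => [[] a] [[] c]; rewrite /pipe_lt //= => h; apply/negbTE; rewrite -leqNgt ltnW //.
Qed.

(** The transfer operator of one cell, acting on functionals. Pipes travel left and down, so [t] and
    [r] are incoming edges and [phi] receives the bottom and left ones. The sum over tiles is
    written out to make the Yang-Baxter equation a polynomial identity; [cell_stepE] recovers the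
    tiles. *)
Definition cell_step o (phi : E -> E -> F) (t r : E) : F :=
  match t, r with
  | None, None => o * phi None None
  | None, Some p =>
      (if from_right p then 1 else 1 + b * o) * phi (Some p) None + phi None (Some p)
  | Some p, None =>
      (if from_right p then 1 + b * o else 1) * phi None (Some p) + phi (Some p) None
  | Some v, Some h =>
      (pipe_lt h v)%:R * phi (Some v) (Some h) +
      (if from_right v == from_right h then (label h < label v)%N%:R * b
       else (from_right v)%:R * (b * (1 + b * o))) * phi (Some h) (Some v)
  end.

(* The three orders differ in the place of the absent pipe: before all pipes, after all pipes, or *)
(* between right pipes and top pipes. *)
Definition none_min e e' : bool :=
  match e, e' with
  | Some p, Some q => pipe_lt q p
  | Some _, None => true
  | None, _ => false
  end.
Definition none_max e e' : bool :=
  match e, e' with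
  | Some p, Some q => pipe_lt q p
  | None, Some _ => true
  | _, None => false
  end.
Definition none_mid e e' : bool :=
  match e, e' with
  | Some p, Some q => pipe_lt q p
  | None, Some p => from_right p
  | Some p, None => ~~ from_right p
  | None, None => false
  end.

(* R-matrix for two adjacent columns (gt = none_min) or rows (gt = none_max) with parameters x1, x2. *)
Definition rmat (gt : E -> E -> bool) (x1 x2 : F) (f : E -> E -> F) (e e' : E) : F :=
  (if none_mid e e' then 1 + b * x2 else 1 + b * x1) * f e e' +
  (if gt e e' then x2 - x1 else 0) * f e' e.


Lemma label_ltgt (a c : 'I_n) : a = c \/ ((a < c)%N = true /\ (c < a)%N = false)
  \/ ((a < c)%N = false /\ (c < a)%N = true).
Proof.
case: (ltngtP a c) => [h|h|/val_inj->]; [by right; left|by right; right|by left].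
Qed.


(** Labels enter the Yang-Baxter identities only through their comparisons, so the check is finite:
    a consistent ordering leaves a polynomial identity, an inconsistent one a contradiction. *)
Local Ltac ybe_cases :=
  repeat match goal with
  | |- context [(nat_of_ord ?a < nat_of_ord ?c)%N] => 
     let h := fresh in let h1 := fresh in let h2 := fresh in
     case: (label_ltgt a c) => [h|[[h1 h2]|[h1 h2]]];
       [subst c; rewrite ?ltnn|rewrite ?h1 ?h2|rewrite ?h1 ?h2]
  end.
Local Ltac ybe_close := rewrite ?mulr0n ?mulr1n; first [ring | exfalso; lia].

(* Two adjacent columns within one row; phi consumes the two bottom edges and the left edge. *)
Lemma ybe_col o1 o2 (phi : E -> E -> E -> F) e e' r :
  rmat none_min o1 o2 (fun e e' => cell_step o1 (fun c' m => cell_step o2 (fun c l => phi c c' l) e m) e' r) e e'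
  = cell_step o2 (fun c' m => cell_step o1 (fun c l => rmat none_min o1 o2 (fun c c' => phi c c' l) c c') e m) e' r.
Proof.
rewrite /rmat.
case: e => [[[] a]|]; case: e' => [[[] c]|]; case: r => [[[] d]|]; 
  rewrite /= /none_mid /none_min /pipe_lt /= ?ltnn /=; ybe_cases; try ybe_close.
Qed.

(* Two adjacent rows within one column; phi consumes the bottom edge and the two left edges. *)
Lemma ybe_row o1 o2 (phi : E -> E -> E -> F) r r' t :
  rmat none_max o2 o1 (fun r r' => cell_step o2 (fun c m => cell_step o1 (fun c' m' => phi c' m m') c r') t r) r r'
  = cell_step o1 (fun c m => cell_step o2 (fun c' m' => rmat none_max o2 o1 (phi c') m m') c r') t r.
Proof.
rewrite /rmat.
case: r => [[[] a]|]; case: r' => [[[] c]|]; case: t => [[[] d]|]; 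
  rewrite /= /none_mid /none_max /pipe_lt /= ?ltnn /=; ybe_cases; try ybe_close.
Qed.

Lemma cell_step_ext o (f g : E -> E -> F) t r :
  (forall c l, f c l = g c l) -> cell_step o f t r = cell_step o g t r.
Proof. by move=> fg; rewrite /cell_step; case: t => [?|]; case: r => [?|]; rewrite !fg. Qed.

Lemma cell_step_lin o x z (f g : E -> E -> F) t r :
  cell_step o (fun c l => x * f c l + z * g c l) t r = x * cell_step o f t r + z * cell_step o g t r.
Proof. by rewrite /cell_step; case: t => [?|]; case: r => [?|]; ring. Qed.

Lemma cell_step_scale o x (f : E -> E -> F) t r :
  cell_step o (fun c l => x * f c l) t r = x * cell_step o f t r.
Proof. by rewrite /cell_step; case: t => [?|]; case: r => [?|]; ring. Qed.

(** The rightmost cell is applied outermost, since it receives [r]; the head of the lists is the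
    leftmost cell and receives the edge [m] emitted by the cells to its right. *)
Fixpoint row_sum (os : seq F) (ts : seq E) (r : E) (phi : seq E -> E -> F) : F :=
  match os, ts with
  | o :: os', t :: ts' =>
      row_sum os' ts' r (fun bs m => cell_step o (fun c l => phi (c :: bs) l) t m)
  | _, _ => phi [::] r
  end.

Lemma row_sum_ext os ts r (f g : seq E -> E -> F) : size os = size ts ->
  (forall bs l, size bs = size ts -> f bs l = g bs l) -> row_sum os ts r f = row_sum os ts r g.
Proof.
elim: os ts f g => [|o os IH] [|t ts] //= f g; first by move=> _ fg; apply: fg.
move=> [sz] fg; apply: IH => // bs m sb; apply: cell_step_ext => c l.
by apply: fg; rewrite /= sb.
Qed.

Lemma row_sum_lin os ts r x z (f g : seq E -> E -> F) : size os = size ts ->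
  row_sum os ts r (fun bs l => x * f bs l + z * g bs l) = x * row_sum os ts r f + z * row_sum os ts r g.
Proof.
elim: os ts f g => [|o os IH] [|t ts] //= f g [sz].
rewrite -IH //; apply: row_sum_ext => // bs l _; exact: cell_step_lin.
Qed.

Lemma row_sum_scale os ts r x (f : seq E -> E -> F) : size os = size ts ->
  row_sum os ts r (fun bs l => x * f bs l) = x * row_sum os ts r f.
Proof.
move=> sz; rewrite -[RHS]addr0 -[in RHS](mul0r (row_sum os ts r f)) -row_sum_lin //.
by apply: row_sum_ext => // bs l _; rewrite mul0r addr0.
Qed.

(** A Fubini rule: a cell step is a fixed linear combination of values of its functional, and
    [row_sum] is linear. *)
Lemma cell_step_row_sum o os ts r (f : E -> E -> seq E -> E -> F) t m : size os = size ts ->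
  cell_step o (fun c l => row_sum os ts r (f c l)) t m =
  row_sum os ts r (fun bs l' => cell_step o (fun c l => f c l bs l') t m).
Proof.
move=> sz; rewrite /cell_step; case: t => [?|]; case: m => [?|];
  rewrite ?row_sum_lin ?row_sum_scale //.
all: by rewrite -[X in _ + X = _]mul1r -row_sum_lin //; apply: row_sum_ext => // *; rewrite mul1r.
Qed.

Fixpoint grid_sum (tl ys : seq F) (rs ts : seq E) (phi : seq E -> F) : F :=
  match ys, rs with
  | y :: ys', r :: rs' =>
      row_sum [seq ominus b t y | t <- tl] ts r
        (fun bs l => (l == None)%:R * grid_sum tl ys' rs' bs phi)
  | _, _ => phi ts
  end.

Lemma grid_sum_ext tl ys rs ts (f g : seq E -> F) : size tl = size ts ->
  (forall bs, size bs = size ts -> f bs = g bs) -> grid_sum tl ys rs ts f = grid_sum tl ys rs ts g.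
Proof.
elim: ys rs ts => [|y ys IH] [|r rs] ts //= sz fg; rewrite ?fg //.
apply: row_sum_ext; rewrite ?size_map // => bs l sb; congr (_ * _).
by apply: IH; rewrite ?sb.
Qed.

Lemma grid_sum_lin tl ys rs ts x z (f g : seq E -> F) : size tl = size ts ->
  grid_sum tl ys rs ts (fun bs => x * f bs + z * g bs) =
  x * grid_sum tl ys rs ts f + z * grid_sum tl ys rs ts g.
Proof.
elim: ys rs ts => [|y ys IH] [|r rs] ts //= sz.
rewrite -row_sum_lin ?size_map //; apply: row_sum_ext; rewrite ?size_map // => bs l sb.
by rewrite IH ?sb // mulrDr !(mulrCA (l == None)%:R).
Qed.

End Transfer.

Fixpoint lswap (T : Type) (p : nat) (s : seq T) : seq T :=
  match p, s with
  | 0, x :: y :: s' => y :: x :: s'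
  | p'.+1, x :: s' => x :: lswap p' s'
  | _, _ => s
  end.

Lemma size_lswap (T : Type) p (s : seq T) : size (lswap p s) = size s.
Proof. by elim: p s => [|p IH] [|x [|y s]] //=; rewrite IH. Qed.

Lemma map_lswap (T U : Type) (f : T -> U) p s : map f (lswap p s) = lswap p (map f s).
Proof. by elim: p s => [|p IH] [|x [|y s]] //=; rewrite ?IH. Qed.

(** * Moving the R-matrix through a row, a pair of rows and the grid *)

Section Exchange.
Variables (F : fieldType) (b : F) (n : nat).
Local Notation E := (option (pipe n)).

Definition rlist (gt : E -> E -> bool) p (x1 x2 : F) (f : seq E -> F) (s : seq E) : F :=
  (if none_mid (nth None s p) (nth None s p.+1) then 1 + b * x2 else 1 + b * x1) * f s +
  (if gt (nth None s p) (nth None s p.+1) then x2 - x1 else 0) * f (lswap p s).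

(** For [p] = 0 the two cells are the innermost ones and [ybe_col] applies; otherwise the head cell
    lies to the left of them and commutes with the R-matrix by linearity. *)
Lemma row_sum_exchange p os ts r (f : seq E -> E -> F) :
  size os = size ts -> (p.+1 < size ts)%N ->
  rlist (@none_min n) p os`_p os`_p.+1 (fun ts => row_sum b (lswap p os) ts r f) ts =
  row_sum b os ts r (fun bs l => rlist (@none_min n) p os`_p os`_p.+1 (f^~ l) bs).
Proof.
elim: p os ts f => [|p IH] [|o1 os] [|t1 ts] //= f.
  case: os ts => [|o2 os] [|t2 ts] //= [sz] _.
  rewrite /rlist /= -row_sum_lin //; apply: row_sum_ext => // bs m _.
  exact: (ybe_col b o1 o2 (fun c c' l => f (c :: c' :: bs) l) t1 t2 m).
case=> sz lt; rewrite {1}/rlist /=.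
have := IH os ts (fun bs m => cell_step b o1 (fun c l => f (c :: bs) l) t1 m) sz lt.
rewrite {1}/rlist => ->; apply: row_sum_ext => // bs m _.
by rewrite {1}/rlist -cell_step_lin.
Qed.

(** Both 1 + b (t ⊖ y) = (1 + b t) / (1 + b y) and the difference of t1 ⊖ y and t2 ⊖ y carry the
    same denominator. So the R-matrix in t1, t2 enters every row, and the factor 1 + b y gained on
    entering is returned on leaving. *)
Lemma rlist_ominus gt p t1 t2 y (f : seq E -> F) s : 1 + b * y != 0 ->
  rlist gt p t1 t2 f s = (1 + b * y) * rlist gt p (ominus b t1 y) (ominus b t2 y) f s.
Proof. by move=> y0; rewrite /rlist /ominus; do 2 case: ifP => _; field. Qed.

Lemma grid_sum_exchange_cols p tl ys rs ts (f : seq E -> F) :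
  size tl = size ts -> (p.+1 < size ts)%N -> {in ys, forall y, 1 + b * y != 0} ->
  rlist (@none_min n) p tl`_p tl`_p.+1 (fun ts => grid_sum b (lswap p tl) ys rs ts f) ts =
  grid_sum b tl ys rs ts (rlist (@none_min n) p tl`_p tl`_p.+1 f).
Proof.
elim: ys rs ts => [|y ys IH] [|r rs] ts //= sz lt hy.
have y0 : 1 + b * y != 0 by apply: hy; rewrite inE eqxx.
rewrite (rlist_ominus _ _ _ _ _ _ y0) map_lswap.
have szm : size [seq ominus b t y | t <- tl] = size ts by rewrite size_map.
have := row_sum_exchange r (fun bs l => (l == None)%:R * grid_sum b (lswap p tl) ys rs bs f) szm lt.
rewrite !(nth_map 0) ?sz ?(ltnW lt) // => ->.
rewrite -row_sum_scale //; apply: row_sum_ext => // bs l sb.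
rewrite -rlist_ominus // -IH ?sb //; first by rewrite /rlist; ring.
by move=> z zy; apply: hy; rewrite inE zy orbT.
Qed.

Lemma row_sum2_exchange tl y1 y2 ts r1 r2 (f : seq E -> E -> E -> F) : size tl = size ts ->
  1 + b * y1 != 0 -> 1 + b * y2 != 0 -> {in tl, forall t, 1 + b * t != 0} ->
  rmat b (@none_max n) y1 y2 (fun r1 r2 =>
    row_sum b [seq ominus b t y2 | t <- tl] ts r1 (fun bs l1 =>
      row_sum b [seq ominus b t y1 | t <- tl] bs r2 (fun bs l2 => f bs l1 l2))) r1 r2 =
  row_sum b [seq ominus b t y1 | t <- tl] ts r1 (fun bs l1 =>
    row_sum b [seq ominus b t y2 | t <- tl] bs r2 (fun bs l2 =>
      rmat b (@none_max n) y1 y2 (f bs) l1 l2)).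
Proof.
move=> + y10 y20; elim: tl ts r1 r2 f => [|t tl IH] [|e ts] //= r1 r2 f [sz] ht.
(* Brings together the two cells of the leftmost column, which the nested row sums keep apart. *)
have H z1 z2 r r' (g : seq E -> E -> E -> F) :
   row_sum b [seq ominus b t z1 | t <- tl] ts r (fun bs m =>
     cell_step b (ominus b t z1) (fun c l1 =>
       row_sum b [seq ominus b t z2 | t <- tl] bs r' (fun bs0 m0 =>
         cell_step b (ominus b t z2) (fun c0 l2 => g (c0 :: bs0) l1 l2) c m0)) e m) =
   row_sum b [seq ominus b t z1 | t <- tl] ts r (fun bs m =>
     row_sum b [seq ominus b t z2 | t <- tl] bs r' (fun bs0 m0 =>
       cell_step b (ominus b t z1) (fun c l1 =>
         cell_step b (ominus b t z2) (fun c0 l2 => g (c0 :: bs0) l1 l2) c m0) e m)).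
  apply: row_sum_ext; rewrite ?size_map // => bs m sb.
  by rewrite cell_step_row_sum // size_map sb.
have t0 : 1 + b * t != 0 by apply: ht; rewrite inE eqxx.
rewrite {1}/rmat !H.
have := IH ts r1 r2 (fun bs m1 m2 => cell_step b (ominus b t y2) (fun c l1 =>
   cell_step b (ominus b t y1) (fun c0 l2 => f (c0 :: bs) l1 l2) c m2) e m1) sz.
rewrite {1}/rmat => ->; last by move=> z zt; apply: ht; rewrite inE zt orbT.
apply: row_sum_ext; rewrite ?size_map // => bs m1 sb.
rewrite cell_step_row_sum ?size_map ?sb //.
apply: row_sum_ext; rewrite ?size_map ?sb // => bs' m2 sb'.
(* In y the parameters change places: t ⊖ y2 and t ⊖ y1 differ by a multiple of y2 - y1. The factor
   is the same before and after the column, hence cancels. *)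
have E1 (g : E -> E -> F) l1 l2 : (1 + b * t) * rmat b (@none_max n) y1 y2 g l1 l2 =
  (1 + b * y1) * (1 + b * y2) * rmat b (@none_max n) (ominus b t y2) (ominus b t y1) g l1 l2.
  by rewrite /rmat /ominus; do 2 case: ifP => _; field; rewrite ?y10 ?y20.
apply: (mulfI t0); rewrite E1 ybe_row.
rewrite -!cell_step_scale; apply: cell_step_ext => c l1.
rewrite -!cell_step_scale; apply: cell_step_ext => c' l2.
exact: esym.
Qed.

(** The R-matrix travels from the right boundary to the left one. There the indicators leave only
    two empty edges, on which it is the scalar 1 + b y_p. *)
Lemma grid_sum_exchange_rows p tl ys rs ts (f : seq E -> F) :
  size tl = size ts -> size ys = size rs -> (p.+1 < size rs)%N ->
  {in tl, forall t, 1 + b * t != 0} -> {in ys, forall y, 1 + b * y != 0} ->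
  rlist (@none_max n) p ys`_p ys`_p.+1 (fun rs => grid_sum b tl (lswap p ys) rs ts f) rs =
  (1 + b * ys`_p) * grid_sum b tl ys rs ts f.
Proof.
move=> + + + ht; elim: p ys rs ts => [|p IH] [|y1 ys] [|r1 rs] ts //= sz.
  case: ys rs => [|y2 ys] [|r2 rs] //= _ _ hy.
  have y10 : 1 + b * y1 != 0 by apply: hy; rewrite inE eqxx.
  have y20 : 1 + b * y2 != 0 by apply: hy; rewrite !inE eqxx orbT.
  have H z1 z2 r r' : row_sum b [seq ominus b t z1 | t <- tl] ts r (fun bs l =>
       (l == None)%:R * row_sum b [seq ominus b t z2 | t <- tl] bs r' (fun bs l' =>
          (l' == None)%:R * grid_sum b tl ys rs bs f)) =
     row_sum b [seq ominus b t z1 | t <- tl] ts r (fun bs l =>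
       row_sum b [seq ominus b t z2 | t <- tl] bs r' (fun bs l' =>
          ((l == None) && (l' == None))%:R * grid_sum b tl ys rs bs f)).
    apply: row_sum_ext; rewrite ?size_map // => bs l sb.
    rewrite -row_sum_scale ?size_map ?sb //; apply: row_sum_ext; rewrite ?size_map ?sb //.
    by move=> bs' l' _; rewrite mulrA -natrM mulnb.
  rewrite /rlist /= !H.
  have := row_sum2_exchange r1 r2 (fun bs l l' => ((l == None) && (l' == None))%:R * grid_sum b tl ys rs bs f) sz y10 y20 ht.
  rewrite {1}/rmat => ->; rewrite -row_sum_scale ?size_map //.
  apply: row_sum_ext; rewrite ?size_map // => bs l sb.
  rewrite -row_sum_scale ?size_map ?sb //; apply: row_sum_ext; rewrite ?size_map ?sb // => bs' l' _.
  by rewrite /rmat; case: l => [?|]; case: l' => [?|] /=; rewrite ?mul0r ?mulr0 ?addr0.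
case=> sz' lt hy; rewrite /rlist /= -row_sum_lin ?size_map // -row_sum_scale ?size_map //.
apply: row_sum_ext; rewrite ?size_map // => bs l sb.
have hy' : {in ys, forall y, 1 + b * y != 0} by move=> z zy; apply: hy; rewrite inE zy orbT.
by rewrite [RHS]mulrCA -(IH ys rs bs) ?sb // /rlist mulrDr !(mulrCA (l == None)%:R).
Qed.
End Exchange.

(** * Puzzle sums as iterated transfer operators *)

Section TupleSum.
Variables (R : nmodType) (C : finType).

Lemma sum_tuple0 (f : seq C -> R) : \sum_(s : 0.-tuple C) f s = f [::].
Proof.
by rewrite (big_pred1 [tuple]) // => s; apply/esym/eqP; rewrite [s]tuple0; apply/val_inj.
Qed.

Lemma sum_tupleS m (f : seq C -> R) :
  \sum_(s : m.+1.-tuple C) f s = \sum_c \sum_(s : m.-tuple C) f (c :: s).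
Proof.
rewrite pair_bigA /= (reindex (fun cs : C * m.-tuple C => [tuple of cs.1 :: cs.2])) //=.
exists (fun s : m.+1.-tuple C => (thead s, [tuple of behead s])) => [[c s]|s] _ /=.
  by rewrite theadE; congr (_, _); apply: val_inj.
by rewrite -tuple_eta.
Qed.

Lemma sum_seq_support (P : pred C) (s : seq C) (f : C -> R) : uniq s -> {subset P <= s} ->
  \sum_(c | P c) f c = \sum_(c <- s | P c) f c.
Proof.
move=> us sub; rewrite [RHS]big_mkcond big_uniq //= -big_mkcondr /=.
by apply: eq_bigl => c; case: (boolP (P c)) => [/sub->|]; rewrite ?andbF.
Qed.
End TupleSum.

Section Tilings.
Variables (F : fieldType) (b : F) (n : nat).
Local Notation E := (option (pipe n)).
Local Notation C := (cell n).

(** The order [pipe_lt] makes sense for arbitrary pipes, as the Yang-Baxter equation demands; inside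
    a puzzle it agrees with the order of labels. *)
Definition cell_lt_ok (c : C) : bool :=
  if c is Cross h v then pipe_lt h v else cell_ok c.

Lemma cell_stepE o phi (t r : E) :
  cell_step b o phi t r =
  \sum_(c : C | [&& right_edge c == r, top_edge c == t & cell_lt_ok c])
     cell_weight b o c * phi (bottom_edge c) (left_edge c).
Proof.
(* The top and right edges leave at most two possible tiles. *)
pose s : seq C := match t, r with
  | None, None => [:: Empty n]
  | Some p, None => [:: JElbow p; Vertical p]
  | None, Some p => [:: FElbow p; Horizontal p]
  | Some v, Some h => [:: Cross h v; Bump v h]
  end.
rewrite (@sum_seq_support _ _ _ s).
- case: t @s => [p|]; case: r => [q|] /=; rewrite ?big_cons big_nil /= ?eqxx /= ?addr0 //.
  + rewrite mul1r; case: ifP => _; rewrite ?mul1r ?mul0r //; case: ifP => // _.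
    * by case: ifP => _; rewrite ?mul1r ?mul0r ?addr0 ?add0r.
    * by case: ifP => _; rewrite ?mul1r ?mul0r ?addr0 ?add0r.
    * by case: ifP => _; rewrite ?mul1r ?mul0r ?addr0 ?add0r.
    * by case: ifP => _; rewrite ?mul1r ?mul0r ?addr0 ?add0r.
  + by rewrite mul1r.
  + by rewrite mul1r.
- by rewrite /s; case: t {s} => [p|]; case: r => [q|].
- move=> c; rewrite unfold_in => /and3P[/eqP er /eqP et _].
  by rewrite /s -er -et; case: c {er et} => *; rewrite /= !inE eqxx ?orbT.
Qed.

(** For no cells this is the right boundary edge itself, so in all cases the right edge of a cell
    must equal [leftmost] of the cells after it. *)
Definition leftmost (r : E) (s : seq C) : E := if s is c :: _ then left_edge c else r.

Fixpoint row_ok (r : E) (ts : seq E) (s : seq C) : bool :=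
  match s, ts with
  | c :: s', t :: ts' =>
      [&& right_edge c == leftmost r s', top_edge c == t, cell_lt_ok c & row_ok r ts' s']
  | [::], [::] => true
  | _, _ => false
  end.

Fixpoint row_weight (os : seq F) (s : seq C) : F :=
  match os, s with
  | o :: os', c :: s' => cell_weight b o c * row_weight os' s'
  | _, _ => 1
  end.

Lemma row_sumE m os ts r (phi : seq E -> E -> F) : size os = m -> size ts = m ->
  row_sum b os ts r phi =
  \sum_(s : m.-tuple C | row_ok r ts s)
     row_weight os s * phi (map (@bottom_edge n) s) (leftmost r s).
Proof.
elim: m os ts phi => [|m IH] [|o os] [|t ts] //= phi.
  move=> _ _; rewrite big_mkcond /=.
  rewrite (sum_tuple0 (fun s => if row_ok r [::] s then 1 * phi (map (@bottom_edge n) s) (leftmost r s) else 0)) /=.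
  by rewrite mul1r.
move=> [so] [st]; rewrite (IH os ts) // [RHS]big_mkcond /=.
rewrite (sum_tupleS m (fun s => if row_ok r (t :: ts) s then row_weight (o :: os) s * phi (map (@bottom_edge n) s) (leftmost r s) else 0)).
rewrite exchange_big /= big_mkcond /=; apply: eq_bigr => s _.
have [rs|rs] := boolP (row_ok r ts s); last first.
  by rewrite big1 // => c _; rewrite !andbF.
rewrite cell_stepE big_distrr /= big_mkcond /=; apply: eq_bigr => c _.
by rewrite andbT; case: ifP => // _; rewrite mulrCA mulrA.
Qed.

Fixpoint grid_ok (rs ts : seq E) (ss : seq (seq C)) : bool :=
  match ss, rs with
  | s :: ss', r :: rs' =>
      [&& row_ok r ts s, leftmost r s == None & grid_ok rs' (map (@bottom_edge n) s) ss']
  | [::], [::] => true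
  | _, _ => false
  end.

Fixpoint grid_weight (tl ys : seq F) (ss : seq (seq C)) : F :=
  match ys, ss with
  | y :: ys', s :: ss' => row_weight [seq ominus b t y | t <- tl] s * grid_weight tl ys' ss'
  | _, _ => 1
  end.

Fixpoint grid_bottom (ts : seq E) (ss : seq (seq C)) : seq E :=
  if ss is s :: ss' then grid_bottom (map (@bottom_edge n) s) ss' else ts.

Lemma grid_sumE m l tl ys rs ts (phi : seq E -> F) :
  size tl = l -> size ts = l -> size ys = m -> size rs = m ->
  grid_sum b tl ys rs ts phi =
  \sum_(ss : m.-tuple (l.-tuple C) | grid_ok rs ts (map val ss))
     grid_weight tl ys (map val ss) * phi (grid_bottom ts (map val ss)).
Proof.
move=> stl; elim: m ys rs ts => [|m IH] [|y ys] [|r rs] //= ts st.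
  move=> _ _; rewrite [RHS]big_mkcond /=.
  rewrite (sum_tuple0 (fun ss => if grid_ok [::] ts (map val ss) then 1 * phi (grid_bottom ts (map val ss)) else 0)) /=.
  by rewrite mul1r.
case=> sy [sr]; rewrite (@row_sumE l) ?size_map // [RHS]big_mkcond /=.
rewrite (sum_tupleS m (fun ss => if grid_ok (r :: rs) ts (map val ss) then grid_weight tl (y :: ys) (map val ss) * phi (grid_bottom ts (map val ss)) else 0)) /=.
rewrite big_mkcond /=; apply: eq_bigr => s _.
have [rok|rok] := boolP (row_ok r ts s); last by rewrite big1.
have [lok|lok] := boolP (leftmost r s == None); last first.
  by rewrite mul0r mulr0 big1.
rewrite mul1r (IH ys rs) ?size_map ?size_tuple // big_distrr /= big_mkcond /=.
by apply: eq_bigr => ss _; case: ifP => // _; rewrite mulrA.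
Qed.

End Tilings.

Section Link.
Variables (n k : nat).
Local Notation E := (option (pipe n)).
Local Notation C := (cell n).
Local Notation tiling := {ffun 'I_n * 'I_n -> cell n}.
Implicit Types (u v w : 'S_n) (T : tiling).

Lemma cell_flow (c : C) p : bottom_edge c = Some p \/ left_edge c = Some p ->
  top_edge c = Some p \/ right_edge c = Some p.
Proof. by case: c => [|? ?|?|?|?|?|? ?] /= [] // ->; auto. Qed.

Lemma interior_okP T : reflect (forall i j l : 'I_n, l = i.+1 :> nat ->
    bottom_edge (T (i, j)) = top_edge (T (l, j)) /\ right_edge (T (j, i)) = left_edge (T (j, l)))
  (interior_ok T).
Proof.
apply: (iffP forallP) => [h i j l e | h i].
  by have /forallP/(_ j)/forallP/(_ l)/implyP := h i; rewrite e eqxx => /(_ isT)/andP[/eqP ? /eqP ?].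
apply/forallP => j; apply/forallP => l; apply/implyP => /eqP e.
by have [-> ->] := h i j l e; rewrite !eqxx.
Qed.

(* A property of positions and pipes that persists downwards and to the left need only be checked *)
(* where pipes enter. *)
Lemma pipe_invariant T (Q : 'I_n -> 'I_n -> pipe n -> Prop) : interior_ok T ->
  (forall (i j : 'I_n) p, i = 0 :> nat -> top_edge (T (i, j)) = Some p -> Q i j p) ->
  (forall (i j : 'I_n) p, j.+1 = n -> right_edge (T (i, j)) = Some p -> Q i j p) ->
  (forall (i i' j : 'I_n) p, i' = i.+1 :> nat -> Q i j p -> Q i' j p) ->
  (forall (i j j' : 'I_n) p, j' = j.+1 :> nat -> Q i j' p -> Q i j p) ->
  forall i j p, top_edge (T (i, j)) = Some p \/ right_edge (T (i, j)) = Some p -> Q i j p.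
Proof.
move=> /interior_okP int top rgt down left i j p.
move: {2}(i + (n - j))%N (leqnn (i + (n - j))) => m; elim: m i j => [|m IH] i j.
  by have := ltn_ord j; lia.
move=> le [e|e].
  case: (posnP i) => [i0|i0]; first exact: top e.
  have lt : (i.-1 < n)%N by have := ltn_ord i; lia.
  have ei : i = (Ordinal lt).+1 :> nat by rewrite /= prednK.
  apply: (down (Ordinal lt)) => //; apply: IH; first by rewrite /=; lia.
  by apply: cell_flow; left; rewrite (int _ j _ ei).1.
case: (ltnP j.+1 n) => [lt|ge]; last by apply: rgt e; have := ltn_ord j; lia.
apply: (left i j (Ordinal lt)) => //; apply: IH; first by rewrite /=; lia.
by apply: cell_flow; right; rewrite -(int j i (Ordinal lt) erefl).2.
Qed.

(** Inside a puzzle the label of a pipe determines its side of entry, so a bottom label determines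
    the whole pipe. *)
Definition compatible (p : pipe n) : bool := from_right p == (label p < k)%N.

Definition frame_ok u v T : Prop :=
  forall i j : 'I_n, [/\ j = 0 :> nat -> left_edge (T (i, j)) = None,
    j.+1 = n -> right_edge (T (i, j)) = right_label k u i
    & i = 0 :> nat -> top_edge (T (i, j)) = top_label k v j].

Lemma frame_compatible u v T : interior_ok T -> frame_ok u v T ->
  forall i j p, top_edge (T (i, j)) = Some p \/ right_edge (T (i, j)) = Some p -> compatible p.
Proof.
move=> int fr; apply: (@pipe_invariant T (fun _ _ p => compatible p)) => // i j p e.
  have [_ _ /(_ e) ->] := fr i j.
  by rewrite /top_label; case: ltnP => // h [<-]; rewrite /compatible /= ltnNge -ltnS h.
have [_ /(_ e) -> _] := fr i j.
by rewrite /right_label; case: ltnP => // h [<-]; rewrite /compatible /= h.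
Qed.

Lemma compatible_inj p q : compatible p -> compatible q -> label p = label q -> p = q.
Proof. by case: p q => [s a] [s' c] /eqP /= -> /eqP /= -> ->. Qed.

Definition bottom_label w (j : 'I_n) : E := let a := (w^-1)%g j in Some ((a < k)%N, a).

(** All pipes are compatible once the boundary is correct. This converts the order of labels into
    [pipe_lt] and bottom labels into bottom pipes, the form used by the transfer operators. *)
Lemma pipe_puzzlesP u v w T : reflect
  [/\ interior_ok T, frame_ok u v T, forall i j : 'I_n, i.+1 = n -> bottom_edge (T (i, j)) = bottom_label w j
    & forall ij, cell_lt_ok (T ij)]
  (T \in pipe_puzzles k u v w).
Proof.
rewrite inE.
have okE : interior_ok T -> frame_ok u v T -> forall ij, cell_ok (T ij) = cell_lt_ok (T ij).
  move=> int fr [i j]; have cp := @frame_compatible u v T int fr i j.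
  case: (T (i, j)) cp => // h q cp.
  have /eqP : compatible h by apply: cp; right.
  have /eqP : compatible q by apply: cp; left.
  by rewrite /= /pipe_lt => -> ->; case: (ltnP (label h) k) => ?; case: (ltnP (label q) k) => ? //=; lia.
have botE : interior_ok T -> frame_ok u v T -> forall i j,
   (omap (@label n) (bottom_edge (T (i, j))) == Some ((w^-1)%g j)) = (bottom_edge (T (i, j)) == bottom_label w j).
  move=> int fr i j; have cp := @frame_compatible u v T int fr i j.
  apply/eqP/eqP => [|-> //]; case e : (bottom_edge _) => [p|] //= [e'].
  congr Some; apply: compatible_inj; last by rewrite /= e'.
    by apply: cp; apply: cell_flow; left.
  by rewrite /compatible /= eqxx.
apply: (iffP and3P) => [[int bd /forallP ok] | [int fr bot ok]].
  have fr : frame_ok u v T.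
    move=> i j; have /forallP/(_ i)/forallP/(_ j)/and4P[h1 h2 h3 _] := bd.
    by split => e; apply/eqP; [move: h1|move: h2|move: h3]; rewrite e eqxx.
  split=> // [i j e|ij]; last by rewrite -okE.
  have /forallP/(_ i)/forallP/(_ j)/and4P[_ _ _] := bd.
  by rewrite e eqxx /= botE // => /eqP.
split=> //; last by apply/forallP => ij; rewrite okE.
apply/forallP => i; apply/forallP => j; have [h1 h2 h3] := fr i j.
by apply/and4P; split; apply/implyP => /eqP e; rewrite ?botE // ?h1 ?h2 ?h3 ?bot.
Qed.

Definition rows T : n.-tuple (n.-tuple C) := [tuple [tuple T (i, j) | j < n] | i < n].

Lemma rows_bij : bijective rows.
Proof.
exists (fun ss : n.-tuple (n.-tuple C) => [ffun ij : 'I_n * 'I_n => tnth (tnth ss ij.1) ij.2]).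
  by move=> T; apply/ffunP => [[i j]]; rewrite ffunE !tnth_mktuple.
move=> ss; apply: eq_from_tnth => i; apply: eq_from_tnth => j.
by rewrite !tnth_mktuple ffunE.
Qed.

Lemma row_okP r ts (s : seq C) : size ts = size s -> reflect
  (forall j, (j < size s)%N -> 
     [/\ right_edge (nth (Empty n) s j) = (if (j.+1 < size s)%N then left_edge (nth (Empty n) s j.+1) else r),
        top_edge (nth (Empty n) s j) = nth None ts j & cell_lt_ok (nth (Empty n) s j)])
  (row_ok r ts s).
Proof.
elim: s ts => [|c s IH] [|t ts] //=; first by move=> _; constructor.
case=> sz; apply: (iffP and4P) => [[/eqP e1 /eqP e2 e3 /(IH _ sz) h] [|j] /= | h].
- by move=> _; split=> //; rewrite e1; case: (s).
- by move=> lt; have [-> -> ->] := h j lt.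
- have [e1 e2 e3] := h 0 isT; split; rewrite ?e2 //.
    by rewrite e1 /=; case: (s).
  by apply/IH => // j lt; have := h j.+1 lt.
Qed.

Lemma grid_okP rs ts (ss : seq (seq C)) : size rs = size ss -> reflect
  (forall i, (i < size ss)%N -> 
     row_ok (nth None rs i) (if i is i'.+1 then map (@bottom_edge n) (nth [::] ss i') else ts) (nth [::] ss i)
     /\ leftmost (nth None rs i) (nth [::] ss i) = None)
  (grid_ok rs ts ss).
Proof.
elim: ss rs ts => [|s ss IH] [|r rs] //= ts; first by move=> _; constructor.
case=> sz; apply: (iffP and3P) => [[e1 /eqP e2 /(IH _ _ sz) h] [|i] //= lt | h].
  by have := h i lt; case: i lt.
have [e1 e2] := h 0 isT; split; rewrite ?e2 //.
by apply/IH => // i lt; have := h i.+1 lt; case: i lt.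
Qed.

Lemma grid_bottomE ts (ss : seq (seq C)) :
  grid_bottom ts ss = if ss is _ :: _ then map (@bottom_edge n) (last [::] ss) else ts.
Proof. by elim: ss ts => //= s ss IH ts; rewrite IH; case: ss IH. Qed.

Definition right_labels u : seq E := [seq right_label k u i | i <- enum 'I_n].
Definition top_labels v : seq E := [seq top_label k v j | j <- enum 'I_n].
Definition bottom_labels w : seq E := [seq bottom_label w j | j <- enum 'I_n].

Lemma nth_enum_map (A : Type) (f : 'I_n -> A) x (i : 'I_n) : nth x [seq f j | j <- enum 'I_n] i = f i.
Proof. by rewrite (nth_map i) ?size_enum_ord // nth_ord_enum. Qed.

Lemma nth_rows T (i : 'I_n) : nth [::] (map val (rows T)) i = [seq T (i, j) | j <- enum 'I_n].
Proof.
by rewrite (nth_map [tuple T (i, j) | j < n]) ?size_tuple // -tnth_nth tnth_mktuple.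
Qed.

Lemma size_enum_map (A : Type) (f : 'I_n -> A) : size [seq f j | j <- enum 'I_n] = n.
Proof. by rewrite size_map size_enum_ord. Qed.

Lemma row_ok_enumP r ts (c : 'I_n -> C) : size ts = n -> reflect
  (forall j : 'I_n, [/\ j.+1 = n -> right_edge (c j) = r,
     forall l : 'I_n, l = j.+1 :> nat -> right_edge (c j) = left_edge (c l),
     top_edge (c j) = nth None ts j & cell_lt_ok (c j)])
  (row_ok r ts [seq c j | j <- enum 'I_n]).
Proof.
move=> st; apply: (iffP (row_okP _ _)); rewrite ?size_enum_map // => h j.
  have := h j (ltn_ord j); rewrite nth_enum_map => -[e1 e2 e3]; split=> //.
    by move=> e; rewrite e1 e ltnn.
  by move=> l el; rewrite e1 -el ltn_ord nth_enum_map.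
move=> lt; have [e1 e2 e3 e4] := h (Ordinal lt).
rewrite -[j]/(val (Ordinal lt)) nth_enum_map; split=> //.
case: ltnP => lt'; first by rewrite (e2 (Ordinal lt')) // -[j.+1]/(val (Ordinal lt')) nth_enum_map.
by apply: e1; apply/eqP; rewrite eqn_leq lt lt'.
Qed.

Lemma leftmost_enumP r (c : 'I_n -> C) : (0 < n)%N -> 
  (leftmost r [seq c j | j <- enum 'I_n] = None) <-> (forall j : 'I_n, j = 0 :> nat -> left_edge (c j) = None).
Proof.
move=> n0; have -> : leftmost r [seq c j | j <- enum 'I_n] = left_edge (c (Ordinal n0)).
  have := size_enum_map c; have := nth_enum_map c (Empty n) (Ordinal n0).
  by case: [seq _ | _ <- _] => [|x s] /=; [move: n0; lia | move=> ->].
by split=> [h j j0|]; [rewrite -h; congr (left_edge (c _)); apply: val_inj|apply].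
Qed.

Lemma grid_rowsP rs ts T : size rs = n -> reflect
  [/\ forall i : 'I_n, i = 0 :> nat -> row_ok (nth None rs i) ts [seq T (i, j) | j <- enum 'I_n],
    forall i l : 'I_n, l = i.+1 :> nat -> row_ok (nth None rs l)
      [seq bottom_edge (T (i, j)) | j <- enum 'I_n] [seq T (l, j) | j <- enum 'I_n]
    & forall i : 'I_n, leftmost (nth None rs i) [seq T (i, j) | j <- enum 'I_n] = None]
  (grid_ok rs ts (map val (rows T))).
Proof.
have szm : size (map val (rows T)) = n by rewrite size_map size_tuple.
move=> sr; apply: (iffP (grid_okP _ (etrans sr (esym szm)))); rewrite ?szm.
  move=> h; split=> [i i0|i l e|i].
  - by have := h i (ltn_ord i); rewrite nth_rows i0 => -[].
  - by have := h l (ltn_ord l); rewrite nth_rows e nth_rows -map_comp => -[].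
  - by have := h i (ltn_ord i); rewrite nth_rows => -[].
move=> [h1 h2 h3] i lt; have := h3 (Ordinal lt); have := h1 (Ordinal lt); have := h2 ^~ (Ordinal lt).
rewrite -[i in nth [::] _ i]/(val (Ordinal lt)) nth_rows /= => {}h2 {}h1 ->; split=> //.
case: i lt h1 h2 => [|i] lt h1 h2; first exact: h1.
by have := h2 (Ordinal (ltnW lt)) erefl; rewrite -[i in nth [::] _ i]/(val (Ordinal (ltnW lt))) nth_rows -map_comp.
Qed.

Lemma enum_map_inj (A : eqType) (f g : 'I_n -> A) :
  [seq f j | j <- enum 'I_n] = [seq g j | j <- enum 'I_n] <-> f =1 g.
Proof.
split=> [e j|/eq_map-> //].
by have := congr1 (fun s => nth (f j) s j) e; rewrite !nth_enum_map.
Qed.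

Lemma puzzle_rows u v w T : (0 < n)%N -> (T \in pipe_puzzles k u v w) =
  grid_ok (right_labels u) (top_labels v) (map val (rows T)) &&
  (grid_bottom (top_labels v) (map val (rows T)) == bottom_labels w).
Proof.
move=> n0.
have szm : size (map val (rows T)) = n by rewrite size_map size_tuple.
have gbE (i : 'I_n) : i.+1 = n -> grid_bottom (top_labels v) (map val (rows T)) =
    [seq bottom_edge (T (i, j)) | j <- enum 'I_n].
  move=> e; rewrite grid_bottomE (_ : last _ _ = [seq T (i, j) | j <- enum 'I_n]).
    by rewrite -map_comp; case: (map val _) szm => //=; lia.
  by rewrite -nth_last -nth_rows; congr nth; rewrite szm; lia.
have [iL eL] : exists i : 'I_n, i.+1 = n.
  have lt : (n.-1 < n)%N by rewrite prednK.
  by exists (Ordinal lt); rewrite /= prednK.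
have st f : size [seq f j : E | j <- enum 'I_n] = n by exact: size_enum_map.
rewrite (gbE iL eL).
apply/pipe_puzzlesP/andP => [[/interior_okP int fr bot ok] | [/grid_rowsP[|h1 h2 h3]]].
- split; last by apply/eqP/enum_map_inj => j; rewrite bot.
  apply/grid_rowsP; rewrite ?st //; split=> [i i0|i l e|i].
  + apply/row_ok_enumP; rewrite ?st // => j; have [f1 f2 f3] := fr i j.
    split=> //; first by move=> /f2 ->; rewrite nth_enum_map.
      by move=> l /int -/(_ i)[].
    by rewrite f3 // nth_enum_map.
  + apply/row_ok_enumP; rewrite ?st // => j; have [f1 f2 f3] := fr l j.
    split=> //; first by move=> /f2 ->; rewrite nth_enum_map.
      by move=> l' /int -/(_ l)[].
    by rewrite nth_enum_map (int i j l e).1.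
  + by apply/leftmost_enumP => // j; have [f1 f2 f3] := fr i j.
- by rewrite st.
move/eqP/enum_map_inj => bot.
have R (i : 'I_n) : exists2 ts, size ts = n & row_ok (nth None (right_labels u) i) ts [seq T (i, j) | j <- enum 'I_n].
  case: (posnP i) => [i0|i0]; first by exists (top_labels v); rewrite ?st //; apply: h1.
  have lt : (i.-1 < n)%N by have := ltn_ord i; lia.
  exists [seq bottom_edge (T (Ordinal lt, j)) | j <- enum 'I_n]; rewrite ?st //.
  by apply: h2; rewrite /= prednK.
split.
- apply/interior_okP => i j l e; split.
    by have := h2 i l e; move/(row_ok_enumP _ _ (st _))/(_ j)=> [_ _ -> _]; rewrite nth_enum_map.
  by have [ts sts /(row_ok_enumP _ _ sts)/(_ i)[_ /(_ _ e)]] := R j.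
- move=> i j; split.
  + by move: j; apply/leftmost_enumP.
  + by have [ts sts /(row_ok_enumP _ _ sts)/(_ j)[h _ _ _]] := R i => /h ->; rewrite nth_enum_map.
  + by move=> i0; have /(row_ok_enumP _ _ (st _))/(_ j)[_ _ -> _] := h1 i i0; rewrite nth_enum_map.
- move=> i j e; rewrite (_ : i = iL); last by apply: val_inj => /=; lia.
  exact: bot.
- by case=> i j; have [ts sts /(row_ok_enumP _ _ sts)/(_ j)[]] := R i.
Qed.

Variables (F : fieldType) (b : F) (t y : nat -> F).

Lemma row_weight_prod m os (s : m.-tuple C) : size os = m ->
  row_weight b os s = \prod_(j < m) cell_weight b os`_j (tnth s j).
Proof.
elim: m os s => [|m IH] [|o os] s //=; first by rewrite big_ord0.
case=> so; case/tupleP: s => c s; rewrite big_ord_recl tnth0 /= IH //.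
by congr (_ * _); apply: eq_bigr => j _; rewrite tnthS.
Qed.

Lemma grid_weight_prod m l tl ys (ss : m.-tuple (l.-tuple C)) : size tl = l -> size ys = m ->
  grid_weight b tl ys (map val ss) =
  \prod_(i < m) \prod_(j < l) cell_weight b (ominus b tl`_j ys`_i) (tnth (tnth ss i) j).
Proof.
move=> sl; elim: m ys ss => [|m IH] [|o os] ss //=; first by rewrite big_ord0.
case=> so; case/tupleP: ss => c ss; rewrite big_ord_recl tnth0 /= IH // (@row_weight_prod l) ?size_map //.
congr (_ * _); first by apply: eq_bigr => j _; rewrite (nth_map 0) // sl.
by apply: eq_bigr => j _; rewrite tnthS.
Qed.

Lemma puzzle_sum u v w : (0 < n)%N ->
  \sum_(T in pipe_puzzles k u v w) puzzle_weight b t y T =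
  grid_sum b (mkseq t n) (mkseq y n) (right_labels u) (top_labels v)
    (fun bs => (bs == bottom_labels w)%:R).
Proof.
move=> n0; rewrite (@grid_sumE _ _ _ n n) ?size_mkseq ?size_enum_map //.
rewrite (reindex rows); last exact/onW_bij/rows_bij.
rewrite big_mkcond [RHS]big_mkcond; apply: eq_bigr => T _.
rewrite puzzle_rows //; case: grid_ok; rewrite ?andFb // andTb (@grid_weight_prod n n) ?size_mkseq //.
case: eqP => _; last by rewrite mulr0.
rewrite mulr1 /puzzle_weight; apply: eq_bigr => i _; apply: eq_bigr => j _.
by rewrite !tnth_mktuple !nth_mkseq.
Qed.

End Link.

(** * Recurrences for puzzle sums *)

Lemma nth_lswap (A : Type) (x : A) p s j : (p.+1 < size s)%N -> nth x (lswap p s) j = nth x s (adj p j).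
Proof.
elim: p s j => [|p IH] [|a s] j //=.
  by case: s => [|c s] //; case: j => [|[|j]].
by case: j => [|j] //= lt; rewrite IH // /adj !eqSS; case: eqP => // _; case: eqP.
Qed.

Lemma lswapK (A : Type) p : involutive (@lswap A p).
Proof. by elim: p => [|p IH] [|a [|c s]] //=; rewrite ?IH //; case: p IH => //= p ->. Qed.

Lemma mkseq_adj (A : Type) (f : nat -> A) p n : (p.+1 < n)%N -> mkseq (f \o adj p) n = lswap p (mkseq f n).
Proof.
move=> lt; apply: (@eq_from_nth _ (f 0)) => [|j]; rewrite ?size_lswap !size_mkseq // => jn.
rewrite nth_lswap ?size_mkseq // !nth_mkseq // /adj.
by case: eqP => // _; case: eqP => // _; apply: ltn_trans lt.
Qed.

Section Recurrences.
Variables (F : fieldType) (b : F) (n k : nat).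
Variables (i i' : 'I_n) (ii' : i' = i.+1 :> nat).
Implicit Types (u v w : 'S_n) (t y : nat -> F).

(** The product of permutations applies its left factor first, so this exchanges the values i and
    i+1: it is s_i u in the usual notation. *)
Definition sl u : 'S_n := (u * tperm i i')%g.

Lemma slV u j : ((sl u)^-1)%g j = (u^-1)%g (tperm i i' j).
Proof. by rewrite /sl invMg tpermV permM. Qed.

Lemma slK : involutive sl.
Proof. by move=> u; rewrite /sl -mulgA tperm2 mulg1. Qed.

Lemma tperm_adj (j : 'I_n) : tperm i i' j = adj i j :> nat.
Proof.
rewrite /adj; case: tpermP => [->|->|/eqP ni /eqP ni']; rewrite ?eqxx ?ii' //.
  by rewrite -[i.+1 == i]/(i.+1 == i) eqn_leq ltnn eqxx.
by rewrite -ii' !val_eqE (negPf ni) (negPf ni').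
Qed.

Lemma lswap_enum (A : Type) (f : 'I_n -> A) :
  lswap i [seq f j | j <- enum 'I_n] = [seq f (tperm i i' j) | j <- enum 'I_n].
Proof.
apply: (@eq_from_nth _ (f i)) => [|j]; rewrite ?size_lswap !size_enum_map // => jn.
rewrite nth_lswap ?size_enum_map -?ii' // -[j]/(val (Ordinal jn)) -tperm_adj.
by rewrite !nth_enum_map.
Qed.

Definition puzzle_Z t y u v w : F := \sum_(T in pipe_puzzles k u v w) puzzle_weight b t y T.

Let n0 : (0 < n)%N. Proof. by case: n i => [[]|]. Qed.
Let in1 : (i.+1 < n)%N. Proof. by rewrite -ii'. Qed.

Lemma top_labels_sl v : top_labels k (sl v) = lswap i (top_labels k v).
Proof. by rewrite lswap_enum; apply: eq_map => j; rewrite /top_label slV. Qed.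
Lemma right_labels_sl v : right_labels k (sl v) = lswap i (right_labels k v).
Proof. by rewrite lswap_enum; apply: eq_map => j; rewrite /right_label slV. Qed.
Lemma bottom_labels_sl v : bottom_labels k (sl v) = lswap i (bottom_labels k v).
Proof. by rewrite lswap_enum; apply: eq_map => j; rewrite /bottom_label slV. Qed.

Lemma nth_enum_i (A : Type) (f : 'I_n -> A) x :
  (nth x [seq f j | j <- enum 'I_n] i = f i) * (nth x [seq f j | j <- enum 'I_n] i.+1 = f i').
Proof. by rewrite nth_enum_map -ii' nth_enum_map. Qed.

(** Every bottom edge carries a pipe. On the labels of w, which ascend at i, the R-matrix is
    diagonal; its off-diagonal entry is seen only on the labels of s_i w. *)
Lemma bottom_exchange w x1 x2 bs : ((w^-1)%g i < (w^-1)%g i')%N ->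
  rlist b (@none_min n) i x1 x2 (fun bs => (bs == bottom_labels k w)%:R) bs =
  (1 + b * x1) * (bs == bottom_labels k w)%:R + (x2 - x1) * (bs == bottom_labels k (sl w))%:R.
Proof.
move=> lt; rewrite bottom_labels_sl -[bs == lswap _ _](inj_eq (can_inj (lswapK i))) lswapK /rlist.
have pl : pipe_lt ((((w^-1)%g i) < k)%N, (w^-1)%g i) ((((w^-1)%g i') < k)%N, (w^-1)%g i').
  by rewrite /pipe_lt /=; case: (ltnP ((w^-1)%g i) k) => ?; case: (ltnP ((w^-1)%g i') k) => ? //=; lia.
congr (_ + _).
  case: eqP => [->|_]; rewrite ?mulr0 // !nth_enum_i /bottom_label /=.
  by rewrite pipe_lt_asym.
case: eqP => [e|_]; rewrite ?mulr0 //.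
have -> : bs = bottom_labels k (sl w) by rewrite bottom_labels_sl -e lswapK.
by rewrite !nth_enum_i /bottom_label !slV tpermL tpermR /= pl.
Qed.

Lemma grid_exchange t y u w ts : size ts = n -> (forall j, 1 + b * y j != 0) -> 
  ((w^-1)%g i < (w^-1)%g i')%N ->
  rlist b (@none_min n) i (t i) (t i.+1) (fun ts => grid_sum b (mkseq (t \o adj i) n) (mkseq y n)
     (right_labels k u) ts (fun bs => (bs == bottom_labels k w)%:R)) ts =
  (1 + b * t i) * grid_sum b (mkseq t n) (mkseq y n) (right_labels k u) ts (fun bs => (bs == bottom_labels k w)%:R)
  + (t i.+1 - t i) * grid_sum b (mkseq t n) (mkseq y n) (right_labels k u) ts (fun bs => (bs == bottom_labels k (sl w))%:R).
Proof.
move=> st hy lt; rewrite mkseq_adj //.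
have := @grid_sum_exchange_cols _ b n i (mkseq t n) (mkseq y n) (right_labels k u) ts
  (fun bs => (bs == bottom_labels k w)%:R).
rewrite !nth_mkseq // => ->; rewrite ?size_mkseq ?st //; last by move=> z /mapP[j jn ->].
by rewrite -grid_sum_lin ?size_mkseq //; apply: grid_sum_ext; rewrite ?size_mkseq // => bs _; apply: bottom_exchange.
Qed.

(** At an ascent of v the top edges of columns i and i+1 are two pipes in order, an absent pipe and
    a pipe from the top, or both empty. In each case the R-matrix acts at the top by 1 + b t_i. *)
Lemma puzzle_Z_col_asc t y u v w : (forall j, 1 + b * y j != 0) -> 
  ((w^-1)%g i < (w^-1)%g i')%N -> ((v^-1)%g i < (v^-1)%g i')%N ->
  (1 + b * t i) * puzzle_Z (t \o adj i) y u v w =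
  (1 + b * t i) * puzzle_Z t y u v w + (t i.+1 - t i) * puzzle_Z t y u v (sl w).
Proof.
move=> hy wlt vlt; rewrite /puzzle_Z !puzzle_sum // -grid_exchange ?size_enum_map //.
rewrite /rlist !nth_enum_i /top_label.
case: ltnP => h; last by case: ltnP => h' /=; rewrite mul0r addr0.
rewrite (leq_trans h) /=; last by rewrite ltnS ltnW.
by rewrite /pipe_lt /= ltnNge (ltnW vlt) /= mul0r addr0.
Qed.

(** Column i carries a pipe at the top because its label is beyond k; column i+1 carries a smaller
    label or nothing. Both [none_min] and [none_mid] see a descent, which yields the term with s_i
    v. *)
Lemma puzzle_Z_col_desc t y u v w : (forall j, 1 + b * y j != 0) -> 
  ((w^-1)%g i < (w^-1)%g i')%N -> ((v^-1)%g i' < (v^-1)%g i)%N -> (k <= (v^-1)%g i)%N ->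
  (1 + b * t i.+1) * puzzle_Z (t \o adj i) y u v w + (t i.+1 - t i) * puzzle_Z (t \o adj i) y u (sl v) w =
  (1 + b * t i) * puzzle_Z t y u v w + (t i.+1 - t i) * puzzle_Z t y u v (sl w).
Proof.
move=> hy wlt vlt kv; rewrite /puzzle_Z !puzzle_sum // -grid_exchange ?size_enum_map //.
rewrite /rlist !nth_enum_i -top_labels_sl /top_label ltnS kv.
by case: ltnP => h //=; rewrite /pipe_lt /= vlt.
Qed.

Lemma puzzle_Z_row t y u v w : (forall j, 1 + b * t j != 0) -> (forall j, 1 + b * y j != 0) -> 
  rlist b (@none_max n) i (y i) (y i.+1) (fun rs => grid_sum b (mkseq t n) (mkseq (y \o adj i) n)
     rs (top_labels k v) (fun bs => (bs == bottom_labels k w)%:R)) (right_labels k u) =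
  (1 + b * y i) * puzzle_Z t y u v w.
Proof.
move=> ht hy; rewrite /puzzle_Z !puzzle_sum // mkseq_adj //.
have := @grid_sum_exchange_rows _ b n i (mkseq t n) (mkseq y n) (right_labels k u) (top_labels k v)
  (fun bs => (bs == bottom_labels k w)%:R).
rewrite !nth_mkseq // => -> //; rewrite ?size_mkseq ?size_enum_map //.
  by move=> z /mapP[j jn ->].
by move=> z /mapP[j jn ->].
Qed.

(** An occupied right edge of row i is followed by a larger label or by an empty edge, and an empty
    one by an empty one; neither [none_max] nor [none_mid] sees a descent. *)
Lemma puzzle_Z_row_asc t y u v w : (forall j, 1 + b * t j != 0) -> (forall j, 1 + b * y j != 0) -> 
  ((u^-1)%g i < (u^-1)%g i')%N ->
  puzzle_Z t (y \o adj i) u v w = puzzle_Z t y u v w.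
Proof.
move=> ht hy ult; apply: (mulfI (hy i)); rewrite -puzzle_Z_row // /puzzle_Z !puzzle_sum //.
rewrite /rlist !nth_enum_i /right_label.
case: (leqP ((u^-1)%g i).+1 k) => h; case: (leqP ((u^-1)%g i').+1 k) => h' /=.
- by rewrite /pipe_lt /= ltnNge (ltnW ult) /= mul0r addr0.
- by rewrite mul0r addr0.
- lia.
- by rewrite mul0r addr0.
Qed.

(** Row i+1 carries a pipe, row i a larger label or nothing. With an absent pipe placed after the
    pipes from the right, both cases are descents and give the term with s_i u. *)
Lemma puzzle_Z_row_desc t y u v w : (forall j, 1 + b * t j != 0) -> (forall j, 1 + b * y j != 0) -> 
  ((u^-1)%g i' < (u^-1)%g i)%N -> ((u^-1)%g i' < k)%N ->
  (1 + b * y i.+1) * puzzle_Z t (y \o adj i) u v w + (y i.+1 - y i) * puzzle_Z t (y \o adj i) (sl u) v w =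
  (1 + b * y i) * puzzle_Z t y u v w.
Proof.
move=> ht hy ult ku; rewrite -puzzle_Z_row // /puzzle_Z !puzzle_sum //.
rewrite /rlist !nth_enum_i -right_labels_sl /right_label ku.
by case: leqP => h //=; rewrite /pipe_lt /= ult.
Qed.

End Recurrences.

(** * Puzzles with identity bottom labels *)

Lemma perm_ge_id n (v : 'S_n) : (forall a : 'I_n, (a <= v a)%N) -> v = 1%g.
Proof.
move=> h; apply/permP => a; rewrite perm1; apply: val_inj.
(* Downward induction: if everything above a is fixed, v a > a would take a value already taken. *)
move: {2}(n - a)%N (leqnn (n - a)) => m; elim: m a => [|m IH] a le; first by have := ltn_ord a; lia.
case: (ltngtP a (v a)) (h a) => // lt _.
have e : v (v a) = v a :> nat by apply: IH; lia.
by move/val_inj/perm_inj/(congr1 val) : e lt => /= ->; rewrite ltnn.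
Qed.

Section Base.
Variables (n k : nat).
Implicit Types (u v w : 'S_n) (T : {ffun 'I_n * 'I_n -> cell n}).

(** A pipe from the top enters in column v a, never moves right, and ends in column w a. *)
Lemma puzzle_bottom_col u v w T (a : 'I_n) : T \in pipe_puzzles k u v w -> (k <= a)%N -> ((w a : nat) <= v a)%N.
Proof.
case/pipe_puzzlesP => int fr bot _ ka.
have n0 : (0 < n)%N by case: (n) a {ka} => [[]|].
have ltl : (n.-1 < n)%N by rewrite prednK.
have := bot (Ordinal ltl) (w a); rewrite /= prednK // => /(_ erefl) e.
have := @pipe_invariant n T (fun (_ j : 'I_n) p => from_right p = false -> ((j : nat) <= v (label p))%N) int.
move=> H; have := H _ _ _ _ (Ordinal ltl) (w a) ((a < k)%N, a); apply=> //.
- move=> i j p i0; have [_ _ /(_ i0)->] := fr i j.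
  by rewrite /top_label; case: ifP => // _ [<-] /=; rewrite permKV.
- move=> i j p j0; have [_ /(_ j0)-> _] := fr i j.
  by rewrite /right_label; case: ifP => // _ [<-].
- by move=> i j j' p e' h s; have := h s; lia.
- by apply: cell_flow; left; rewrite e /bottom_label permK.
- by rewrite /= ltnNge ka.
Qed.

(** It is enough that a <= v a for all a: beyond k this is the drift of the pipes to the left, below
    k it follows from v being increasing there. *)
Lemma puzzles_id_empty u v T : (forall a c : 'I_n, (a < c < k)%N -> (v a < v c)%N) ->
  T \in pipe_puzzles k u v 1%g -> v = 1%g.
Proof.
move=> sv PT; apply: perm_ge_id => a.
case: (ltnP a k) => ak; last by have := puzzle_bottom_col PT ak; rewrite perm1.
case: a ak => m ltm /=; elim: m ltm => // m IH ltm mk.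
have := IH (ltnW ltm) (ltnW mk); have := sv (Ordinal (ltnW ltm)) (Ordinal ltm).
by rewrite /= ltnSn mk => /(_ isT); lia.
Qed.

(** For w = 1 the pipe ends in the column of its own label and only moves left on the way, so
    followed forwards it is never to the left of that column. *)
Lemma puzzle_label_col u v T i j p : T \in pipe_puzzles k u v 1%g ->
  bottom_edge (T (i, j)) = Some p \/ left_edge (T (i, j)) = Some p -> (label p <= j)%N.
Proof.
case/pipe_puzzlesP => /interior_okP int fr bot _.
have flow (c : cell n) q : top_edge c = Some q \/ right_edge c = Some q ->
  bottom_edge c = Some q \/ left_edge c = Some q by case: c => [|? ?|?|?|?|?|? ?] /= [] // ->; auto.
move: {2}(j + (n - i))%N (leqnn (j + (n - i))) => m; elim: m i j => [|m IH] i j.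
  by have := ltn_ord i; lia.
move=> le [e|e].
  case: (ltnP i.+1 n) => [lt|ge]; last first.
    have en : i.+1 = n by have := ltn_ord i; lia.
    by move: e; rewrite (bot i j en) /bottom_label invg1 perm1 => -[<-].
  apply: (IH (Ordinal lt)); first by rewrite /=; lia.
  by apply: flow; left; rewrite -(int i j (Ordinal lt) erefl).1.
case: (posnP j) => j0; first by move: e; have [-> ] := fr i j.
have lt : (j.-1 < n)%N by have := ltn_ord j; lia.
have ej : j = (Ordinal lt).+1 :> nat by rewrite /= prednK.
apply: (@leq_trans (Ordinal lt)); last by rewrite /=; lia.
apply: (IH i); first by rewrite /=; lia.
by apply: flow; right; rewrite (int (Ordinal lt) i j ej).2.
Qed.

(** The pipe continues into column j - 1, where [puzzle_label_col] applies. *)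
Lemma puzzle_left_label u v T i j p : T \in pipe_puzzles k u v 1%g ->
  left_edge (T (i, j)) = Some p -> (label p < j)%N.
Proof.
move=> PT e; case/pipe_puzzlesP: (PT) => /interior_okP int fr bot _.
case: (posnP j) => j0; first by move: e; have [-> ] := fr i j.
have lt : (j.-1 < n)%N by have := ltn_ord j; lia.
have ej : j = (Ordinal lt).+1 :> nat by rewrite /= prednK.
apply: (@leq_ltn_trans (Ordinal lt)); last by rewrite /=; lia.
have e' : right_edge (T (i, Ordinal lt)) = Some p by rewrite (int (Ordinal lt) i j ej).2.
apply: (@puzzle_label_col u v T i _ p PT).
by case: (T _) e' => [|? ?|?|?|?|?|? ?] /= // ->; auto.
Qed.

(* The puzzle for u maximal and v = w = 1: row i carries the pipe n - 1 - i of the right side to column *)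
(* n - 1 - i, where it turns down and stays. *)
Definition corner_puzzle : {ffun 'I_n * 'I_n -> cell n} :=
  [ffun ij : 'I_n * 'I_n => let i := ij.1 in let j := ij.2 in let a := rev_ord i in
    if (a < k)%N then
      if (j < a)%N then Empty n
      else if (j == a :> nat) then FElbow (true, a) else Cross (true, a) ((j < k)%N, j)
    else if (j < k)%N then Empty n else Vertical (false, j)].

Local Notation T0 := corner_puzzle.

Lemma corner_edges (i j : 'I_n) :
  [/\ top_edge (T0 (i, j)) = (if (k <= j)%N || (rev_ord i < j)%N then Some ((j < k)%N, j) else None),
    right_edge (T0 (i, j)) = (if (rev_ord i < k)%N && (rev_ord i <= j)%N then Some (true, rev_ord i) else None),
    bottom_edge (T0 (i, j)) = (if (k <= j)%N || (rev_ord i <= j)%N then Some ((j < k)%N, j) else None)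
    & left_edge (T0 (i, j)) = (if (rev_ord i < k)%N && (rev_ord i < j)%N then Some (true, rev_ord i) else None)].
Proof.
rewrite ffunE; set a := rev_ord i => /=.
case: (ltnP a k) => ak /=; last first.
  case: (ltnP j k) => jk /=; last by [].
  have -> : (a < j)%N = false by lia.
  by have -> : (a <= j)%N = false by lia.
case: (ltngtP j a) => [ja|ja|/val_inj ->] /=.
- by have -> : (k <= j)%N = false by lia.
- by rewrite !orbT.
- have -> : (k <= a)%N = false by lia.
  by rewrite ak.
Qed.

Variable u : 'S_n.
Hypothesis umax : forall a : 'I_n, (a < k)%N -> u a = rev_ord a.

Lemma right_label_max i : right_label k u i = if (rev_ord i < k)%N then Some (true, rev_ord i) else None.
Proof.
rewrite /right_label; set a := (u^-1)%g i; have ui : u a = i by rewrite permKV.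
case: ifP => h; first by have e : rev_ord i = a; [rewrite -ui umax // rev_ordK | rewrite e h].
case: ifP => // h'; have e : rev_ord i = a by apply: (@perm_inj _ u); rewrite ui umax // rev_ordK.
by move: h; rewrite -e h'.
Qed.

Lemma top_label_id (j : 'I_n) : top_label k 1%g j = if (k <= j)%N then Some (false, j) else None.
Proof. by rewrite /top_label invg1; rewrite perm1 ltnS. Qed.

Lemma corner_puzzle_ok : T0 \in pipe_puzzles k u 1%g 1%g.
Proof.
apply/pipe_puzzlesP; split.
- apply/interior_okP => i j l e; have [_ _ -> _] := corner_edges i j; have [-> _ _ _] := corner_edges l j.
  have [_ -> _ _] := corner_edges j i; have [_ _ _ ->] := corner_edges j l.
  split; last by rewrite e ltnS.
  congr (if _ || _ then _ else _); rewrite /= e; have := ltn_ord l; lia.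
- move=> i j; have [-> -> _ ->] := corner_edges i j; rewrite right_label_max top_label_id; split=> [j0|jn|i0].
  + by rewrite j0 ltn0 andbF.
  + have -> : (rev_ord i <= j)%N by have := ltn_ord (rev_ord i); lia.
    by rewrite andbT.
  + have -> : (rev_ord i < j)%N = false by have := ltn_ord j; rewrite /=; lia.
    by rewrite orbF leqNgt; case: ifP => // /negbTE ->.
- move=> i j e; have [_ _ -> _] := corner_edges i j.
  have -> : (rev_ord i <= j)%N by rewrite /= e subnn.
  by rewrite orbT /bottom_label invg1 perm1.
- case=> i j; rewrite ffunE /=; case: ifP => //= h; last by case: ifP.
  case: ltngtP => //= h'; rewrite /pipe_lt /=.
  by case: ltnP => //=.
Qed.

(** Tiles are compared outwards from the top right corner. Wherever the incoming edges allow a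
    second tile (a J-elbow, a bumping tile or a horizontal tile), that tile would send the pipe
    labelled j through the left side of column j, against [puzzle_left_label]. *)
Lemma corner_puzzle_unique T : T \in pipe_puzzles k u 1%g 1%g -> T = T0.
Proof.
move=> PT; have left_lt := fun i j p => @puzzle_left_label u 1%g T i j p PT.
case/pipe_puzzlesP: (PT) => /interior_okP int fr _ _.
have main i j : top_edge (T (i, j)) = top_edge (T0 (i, j)) ->
   right_edge (T (i, j)) = right_edge (T0 (i, j)) -> T (i, j) = T0 (i, j).
  have := left_lt i j; have [-> -> _ _] := corner_edges i j; rewrite ffunE; set a := rev_ord i => /=.
  case: (ltnP a k) => ak /=; last first.
    case: (ltnP j k) => jk /=.
      have -> : (a < j)%N = false by lia.
      by case: (T (i, j)).
    case: (T (i, j)) => //= p l [ep] _; last by rewrite ep.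
    by have := l _ erefl; rewrite ep ltnn.
  case: (ltngtP j a) => [ja|ja|/val_inj ja] /=.
  - have -> : (k <= j)%N = false by lia.
    by case: (T (i, j)).
  - rewrite orbT; case: (T (i, j)) => //= p q l [ep] [eq]; first by rewrite ep eq.
    by have := l _ erefl; rewrite ep ltnn.
  - have -> : (k <= j)%N = false by rewrite ja; lia.
    case: (T (i, j)) => //= p l _ [ep]; first by rewrite ep.
    by have := l _ erefl; rewrite ep ja ltnn.
apply/ffunP => -[i j].
move: {2}(i + (n - j))%N (leqnn (i + (n - j))) => m; elim: m i j => [|m IH] i j.
  by have := ltn_ord j; lia.
move=> le; have /pipe_puzzlesP[/interior_okP int0 fr0 _ _] := corner_puzzle_ok.
apply: main.
  case: (posnP i) => i0; first by have [_ _ /(_ i0)->] := fr i j; have [_ _ /(_ i0)->] := fr0 i j.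
  have lt : (i.-1 < n)%N by have := ltn_ord i; lia.
  have ei : i = (Ordinal lt).+1 :> nat by rewrite /= prednK.
  rewrite -(int _ j _ ei).1 -(int0 _ j _ ei).1 IH //=; lia.
case: (ltnP j.+1 n) => [lt|ge].
  by rewrite (int j i (Ordinal lt) erefl).2 (int0 j i (Ordinal lt) erefl).2 IH //=; lia.
have jn : j.+1 = n by have := ltn_ord j; lia.
by have [_ /(_ jn)-> _] := fr i j; have [_ /(_ jn)-> _] := fr0 i j.
Qed.

(** In the only puzzle every nonempty tile has weight 1, and the empty tiles of row i are those in
    columns j < k to the left of column n - 1 - i. *)
Lemma puzzle_Z_max (F : fieldType) (b : F) (t y : nat -> F) :
  puzzle_Z b k t y u 1%g 1%g =
  \prod_(j < n | (j < k)%N) \prod_(i < n | (i.+1 + j.+1 <= n)%N) ominus b (t j) (y i).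
Proof.
rewrite /puzzle_Z (big_pred1 T0); last first.
  move=> T; apply/idP/eqP => [|->]; first exact: corner_puzzle_unique.
  exact: corner_puzzle_ok.
rewrite /puzzle_weight exchange_big [RHS]big_mkcond; apply: eq_bigr => j _.
rewrite [in RHS]big_mkcond /=; case: ifP => jk.
  apply: eq_bigr => i _; rewrite ffunE /=.
  have -> : (i.+1 + j.+1 <= n)%N = (j < n - i.+1)%N by lia.
  case: (ltnP (n - i.+1) k) => h; last by rewrite jk (leq_trans jk h).
  by case: ltngtP => //; case: ltnP.
rewrite big1 // => i _; rewrite ffunE /=.
case: ifP => h; last by rewrite jk.
have -> : (j < n - i.+1)%N = false by lia.
by case: eqP.
Qed.

End Base.

(** * Permutations and inversions *)

Lemma adj_l i : adj i i = i.+1. Proof. by rewrite /adj eqxx. Qed.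
Lemma adj_r i : adj i i.+1 = i. Proof. by rewrite -[in adj _ i.+1](adj_l i) adjK. Qed.
Lemma adj_out i j : j != i -> j != i.+1 -> adj i j = j.
Proof. by rewrite /adj => /negPf-> /negPf->. Qed.
Lemma adj_inj i : injective (adj i). Proof. exact: can_inj (adjK i). Qed.

Lemma adj_lt i x y : (x < y)%N -> ~~ ((x == i) && (y == i.+1)) -> (adj i x < adj i y)%N.
Proof. rewrite /adj; case: (eqVneq x i); case: (eqVneq y i); case: (eqVneq x i.+1); case: (eqVneq y i.+1) => //=; lia. Qed.

Section Sinf.
Implicit Types (z : Sinf) (i j : nat).

Lemma sinf_ext (z1 z2 : Sinf) : z1 =1 z2 -> z1 = z2.
Proof. by move=> e; apply: val_inj; apply/fsfunP. Qed.

Lemma sinf_inj z : injective z. Proof. exact: bij_inj (sinf_bij z). Qed.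

Lemma sinf_surj z j : exists i, z i == j.
Proof. by have [g _ gK] := sinf_bij z; exists (g j); rewrite gK. Qed.

Definition sinv z j : nat := xchoose (sinf_surj z j).

Lemma sinvKV z j : z (sinv z j) = j. Proof. exact/eqP/(xchooseP (sinf_surj z j)). Qed.
Lemma sinvK z i : sinv z (z i) = i. Proof. by apply: (@sinf_inj z); rewrite sinvKV. Qed.
Lemma sinv_eq z i j : z i = j -> sinv z j = i. Proof. by move=> <-; rewrite sinvK. Qed.
Lemma sinv_inj z : injective (sinv z). Proof. exact: can_inj (sinvKV z). Qed.

Lemma mulsrE z i j : mulsr z i j = z (adj i j). Proof. exact: mulsr_funE. Qed.

Lemma mulsrK z i : mulsr (mulsr z i) i = z.
Proof. by apply: sinf_ext => j; rewrite !mulsrE adjK. Qed.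

Definition mulsl_fun z i : {fsfun nat -> nat of x => x} :=
  [fsfun j in (sinv z i |` (sinv z i.+1 |` finsupp z))%fset => adj i (z j)].

Lemma mulsl_funE z i j : mulsl_fun z i j = adj i (z j).
Proof.
rewrite fsfunE; case: ifP => // /negbT; rewrite !in_fset1U !negb_or => /and3P[h1 h2 h3].
rewrite fsfun_dflt // adj_out // -(fsfun_dflt h3).
  by apply: contra h1 => /eqP/sinv_eq ->.
by apply: contra h2 => /eqP/sinv_eq ->.
Qed.

Fact mulsl_bij z i : fsbij (mulsl_fun z i).
Proof.
apply/fsbijP; apply: (@eq_bij _ _ (adj i \o z)); last by move=> j; rewrite mulsl_funE.
by apply: bij_comp (sinf_bij z); exists (adj i); apply: adjK.
Qed.

Definition mulsl z i : Sinf := MkSinf (mulsl_bij z i).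

Lemma mulslE z i j : mulsl z i j = adj i (z j). Proof. exact: mulsl_funE. Qed.

Lemma mulslK z i : mulsl (mulsl z i) i = z.
Proof. by apply: sinf_ext => j; rewrite !mulslE adjK. Qed.

Lemma mulslr z i j : mulsr (mulsl z i) j = mulsl (mulsr z j) i.
Proof. by apply: sinf_ext => l; rewrite !(mulslE, mulsrE). Qed.

Lemma sinv_mulsr z i j : sinv (mulsr z i) j = adj i (sinv z j).
Proof. by apply: sinv_eq; rewrite mulsrE adjK sinvKV. Qed.
Lemma sinv_mulsl z i j : sinv (mulsl z i) j = sinv z (adj i j).
Proof. by apply: sinv_eq; rewrite mulslE sinvKV adjK. Qed.

Definition ldes i z : bool := (sinv z i.+1 < sinv z i)%N.

Lemma ldesN i z : ~~ ldes i z = (sinv z i < sinv z i.+1)%N.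
Proof. by rewrite /ldes -leqNgt leq_eqVlt (inj_eq (@sinv_inj z)) eqn_leq ltnn andbF. Qed.

Lemma ldes_mulsl i z : ldes i (mulsl z i) = ~~ ldes i z.
Proof. by rewrite ldesN /ldes !sinv_mulsl adj_l adj_r. Qed.

(** The excluded case is z s_j = s_i z, where the left descent at i is lost. *)
Lemma ldes_mulsr i j z : (z j.+1 < z j)%N -> ~~ ((z j == i.+1) && (z j.+1 == i)) ->
  ldes i (mulsr z j) = ldes i z.
Proof.
move=> dz nz; rewrite {1}/ldes !sinv_mulsr; have [l|l] := boolP (ldes i z).
  by apply: adj_lt => //; apply: contra nz => /andP[/eqP <- /eqP <-]; rewrite !sinvKV !eqxx.
rewrite ltnNge ltnW //; apply: adj_lt; first by rewrite -ldesN.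
by apply/negP => /andP[/eqP e1 /eqP e2]; move: dz; rewrite -e2 -[in z j]e1 !sinvKV ltnNge leqnSn.
Qed.

Definition sid : Sinf := embed (1%g : 'S_0).
Lemma sidE j : sid j = j. Proof. exact: embed_out. Qed.

End Sinf.

Definition inversions n (f : nat -> nat) : nat := \sum_(x < n) \sum_(y < n) ((x < y) && (f y < f x))%N.

Lemma inversions_adj n f i : (i.+1 < n)%N -> (f i < f i.+1)%N ->
  inversions n (f \o adj i) = (inversions n f).+1.
Proof.
move=> lt fi; have lt' := ltnW lt.
pose I0 := Ordinal lt'; pose I1 := Ordinal lt.
have te (x : 'I_n) : tperm I0 I1 x = adj i x :> nat by exact: tperm_adj.
have -> : inversions n (f \o adj i) = (\sum_(x < n) \sum_(y < n) ((adj i x < adj i y) && (f y < f x)))%N.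
  rewrite /inversions (reindex_inj (@perm_inj _ (tperm I0 I1))); apply: eq_bigr => x _.
  rewrite (reindex_inj (@perm_inj _ (tperm I0 I1))); apply: eq_bigr => y _.
  by rewrite /= !te !adjK.
(* [adj i] preserves the order of every pair other than i, i+1; that pair supplies the one new
   inversion. *)
transitivity (\sum_(x < n) \sum_(y < n) (((x < y) && (f y < f x)) + ((x == I1) && (y == I0))))%N.
  apply: eq_bigr => x _; apply: eq_bigr => y _.
  rewrite -!val_eqE /=.
  have [/andP[/eqP-> /eqP->]|nxy] := boolP (((x : nat) == i.+1) && ((y : nat) == i)).
    by rewrite adj_l adj_r ltnSn fi ltnNge leqnSn.
  rewrite addn0; congr (nat_of_bool _).
  have [/andP[/eqP-> /eqP->]|nxy'] := boolP (((x : nat) == i) && ((y : nat) == i.+1)).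
    by rewrite [(f i.+1 < _)%N]ltnNge (ltnW fi) !andbF.
  case: (ltngtP x y) => [l|l|/val_inj->]; rewrite ?ltnn //.
    by rewrite adj_lt.
  by rewrite ltnNge ltnW // adj_lt // andbC.
under eq_bigr do rewrite big_split /=.
rewrite big_split /= -addn1; congr (_ + _)%N.
rewrite (bigD1 I1) //= (bigD1 I0) //= !eqxx /= !big1 ?addn0 // => [x /negPf h|x /negPf h].
  by rewrite big1 // => y _; rewrite h.
by rewrite h.
Qed.

Lemma inversions_ext n f g : (forall x, (x < n)%N -> f x = g x) -> inversions n f = inversions n g.
Proof. by move=> e; apply: eq_bigr => x _; apply: eq_bigr => y _; rewrite !e. Qed.

Lemma inversions_adj_le n f i : (i.+1 < n)%N -> f i != f i.+1 -> (inversions n (f \o adj i) <= (inversions n f).+1)%N.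
Proof.
move=> lt; rewrite neq_ltn => /orP[h|h]; first by rewrite inversions_adj.
have := @inversions_adj n (f \o adj i) i lt; rewrite /= adj_l adj_r => /(_ h).
rewrite (@inversions_ext n _ f) => [->|x _ /=]; by rewrite ?adjK // ltnW.
Qed.

Lemma inversions_le n f : (inversions n f <= n * n)%N.
Proof.
apply: (@leq_trans (\sum_(x < n) \sum_(y < n) 1)%N); first by apply: leq_sum => x _; apply: leq_sum => y _; case: (_ && _).
by rewrite !sum_nat_const !card_ord muln1.
Qed.

Section Embed.
Variable n : nat.
Implicit Types (p w : 'S_n).

Lemma embed1 : embed (1%g : 'S_n) = sid.
Proof.
apply: sinf_ext => j; rewrite sidE; case: (ltnP j n) => lt; last exact: embed_out.
by rewrite (embedE 1%g (Ordinal lt)) perm1.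
Qed.

Lemma embed_inj p w : embed p = embed w -> p = w.
Proof. by move=> e; apply/permP => i; apply: val_inj; rewrite /= -!embedE e. Qed.

Lemma sinv_embed p (j : 'I_n) : sinv (embed p) j = (p^-1)%g j.
Proof. by apply: sinv_eq; rewrite embedE permKV. Qed.

Lemma sinv_embed_out p j : (n <= j)%N -> sinv (embed p) j = j.
Proof. by move=> nj; apply: sinv_eq; apply: embed_out. Qed.

Section Adjacent.
Variables (i i' : 'I_n) (ii' : i' = i.+1 :> nat).

Lemma embed_mulsr p : embed (tperm i i' * p)%g = mulsr (embed p) i.
Proof.
apply: sinf_ext => j; rewrite mulsrE; case: (ltnP j n) => lt.
  by rewrite (embedE _ (Ordinal lt)) permM -[j in RHS]/(val (Ordinal lt)) -(tperm_adj ii') embedE.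
rewrite embed_out // embed_out ?adj_out //; have := ltn_ord i'; rewrite ?ii' ?neq_ltn; lia.
Qed.

Lemma embed_mulsl p : embed (sl i i' p) = mulsl (embed p) i.
Proof.
apply: sinf_ext => j; rewrite mulslE; case: (ltnP j n) => lt.
  by rewrite (embedE _ (Ordinal lt)) permM (embedE p (Ordinal lt)) (tperm_adj ii').
rewrite !embed_out // adj_out //; have := ltn_ord i'; rewrite ?ii' ?neq_ltn; lia.
Qed.

Lemma ldes_embed p : ldes i (embed p) = ((p^-1)%g i' < (p^-1)%g i)%N.
Proof. by rewrite /ldes -ii' !sinv_embed. Qed.
End Adjacent.

Lemma perm_ascents_id p : (forall i i' : 'I_n, i' = i.+1 :> nat -> (p i < p i')%N) -> p = 1%g.
Proof.
move=> h; apply: perm_ge_id => -[m ltm] /=; elim: m ltm => // m IH ltm.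
by have := IH (ltnW ltm); have := h (Ordinal (ltnW ltm)) (Ordinal ltm) erefl; lia.
Qed.

Lemma perm_neq p (i i' : 'I_n) : i' = i.+1 :> nat -> p i != p i' :> nat.
Proof. by move=> e; rewrite (inj_eq val_inj) (inj_eq perm_inj) -val_eqE /= e neq_ltn ltnSn. Qed.

Lemma perm_descent_ex p : p != 1%g -> exists i i' : 'I_n, i' = i.+1 :> nat /\ (p i' < p i)%N.
Proof.
move=> p1; have [/existsP[i /existsP[i' /andP[/eqP e l]]]|h] :=
   boolP [exists i : 'I_n, exists i' : 'I_n, (i' == i.+1 :> nat) && (p i' < p i)%N]; first by exists i, i'.
case/eqP: p1; apply: perm_ascents_id => i i' e.
move: h; rewrite negb_exists => /forallP/(_ i); rewrite negb_exists => /forallP/(_ i').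
by rewrite e eqxx /= -leqNgt leq_eqVlt (negPf (perm_neq p e)).
Qed.

Lemma longestE (x : 'I_n) : longest n x = rev_ord x.
Proof. by rewrite permE. Qed.

Lemma longestK (x : 'I_n) : longest n (longest n x) = x.
Proof. by rewrite !longestE rev_ordK. Qed.

Lemma longestV : ((longest n)^-1)%g = longest n.
Proof. by apply/permP => x; apply: (@perm_inj _ (longest n)); rewrite permKV longestK. Qed.

Lemma perm_ascent_ex p : p != longest n -> exists i i' : 'I_n, i' = i.+1 :> nat /\ (p i < p i')%N.
Proof.
move=> pl; have : (p * longest n)%g != 1%g by rewrite -longestV -eq_mulgV1.
case/perm_descent_ex => i [i' [e]]; rewrite !permM !longestE /= => l; exists i, i'; split=> //.
have := ltn_ord (p i); have := ltn_ord (p i'); lia.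
Qed.

Lemma perm_ge_rev p : (forall x : 'I_n, (rev_ord x <= p x)%N) -> p = longest n.
Proof.
move=> h; have : (longest n * p)%g = 1%g.
  by apply: perm_ge_id => x; rewrite permM longestE; have := h (rev_ord x); rewrite rev_ordK.
by move=> e; rewrite -[p]mul1g -(mulVg (longest n)) -mulgA e mulg1 longestV.
Qed.

Lemma inversions_embed_gt0 p : p != 1%g -> (0 < inversions n (embed p))%N.
Proof.
case/perm_descent_ex => i [i' [e l]].
by rewrite /inversions (bigD1 i) //= (bigD1 i') //= !embedE l e ltnSn.
Qed.

Lemma inversions_sid : inversions n sid = 0%N.
Proof.
rewrite /inversions big1 // => x _; rewrite big1 // => y _; rewrite !sidE.
by case: ltngtP.
Qed.

End Embed.

Lemma sinf_embed (z : Sinf) : exists N, forall n, (N <= n)%N -> exists p : 'S_n, z = embed p.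
Proof.
exists (\max_(j <- finsupp z) j.+1)%N => n le.
have out j : (n <= j)%N -> z j = j.
  move=> nj; apply: fsfun_dflt; apply/negP => jz.
  have := leq_trans (@leq_bigmax_seq _ _ xpredT succn j jz isT) le; lia.
have st j : (j < n)%N -> (z j < n)%N.
  move=> jn; rewrite ltnNge; apply/negP => nz; have := out _ nz => /(@sinf_inj z) e.
  by move: nz; rewrite e leqNgt jn.
pose f (x : 'I_n) : 'I_n := Ordinal (st x (ltn_ord x)).
have fi : injective f by move=> x y /(congr1 val) /= /(@sinf_inj z) /val_inj.
exists (perm fi); apply: sinf_ext => j; case: (ltnP j n) => jn; last by rewrite out ?embed_out.
by rewrite (embedE _ (Ordinal jn)) permE.
Qed.

(** * Evaluation and substitution of polynomials *)

Lemma malgX_inj (I : choiceType) (R : nzRingType) :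
  injective (fun i : I => << ucm i >> : {malg R[{cmonom I}]}).
Proof.
move=> i j /= e; have : (<< ucm j >> : {malg R[{cmonom I}]})@_(ucm i) = 1 by rewrite -e mcoeffUU.
rewrite mcoeffU; case: eqP => [h _|_ /esym/eqP]; last by rewrite oner_eq0.
by have := congr1 (fun m : {cmonom I} => m i) h; rewrite !ucmE eqxx; case: (eqVneq j i).
Qed.

Section Evaluation.
Variables (F : fieldType).
Local Notation polyx := {malg F[{cmonom nat}]}.
Implicit Types (f g h : polyx) (m : {cmonom nat}).

(** The product occurring in [xsubst], over any commutative ring, so that one proof of
    multiplicativity serves both substitution and evaluation in the field. *)
Definition monev (S : comRingType) (g : nat -> S) (m : {cmonom nat}) : S :=
  \prod_(j <- finsupp m) g j ^+ m j.

Lemma monevE (S : comRingType) (g : nat -> S) m (d : {fset nat}) : (finsupp m `<=` d)%fset ->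
  monev g m = \prod_(j <- d) g j ^+ m j.
Proof.
move=> sub; rewrite /monev (big_fset_incl _ sub) // => j _ jm.
by rewrite (fsfun_dflt jm) expr0.
Qed.

Lemma monev_mmorphism (S : comRingType) (g : nat -> S) : mmorphism (monev g).
Proof.
split=> [m1 m2|]; last by rewrite /monev mdom1 big_nil.
rewrite (@monevE _ _ _ (finsupp m1 `|` finsupp m2)%fset); last by rewrite mdomD.
rewrite (@monevE _ _ m1 _ (fsubsetUl _ (finsupp m2))) (@monevE _ _ m2 _ (fsubsetUr (finsupp m1) _)).
by rewrite -big_split; apply: eq_bigr => j _; rewrite cmM exprD.
Qed.

Lemma monev_ext (S : comRingType) (g h : nat -> S) m : g =1 h -> monev g m = monev h m.
Proof. by move=> e; apply: eq_bigr => j _; rewrite e. Qed.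

HB.instance Definition _ (S : comRingType) (g : nat -> S) :=
  isMultiplicative.Build _ _ (monev g) (monev_mmorphism g).

Lemma monevU (S : comRingType) (g : nat -> S) i : monev g (ucm i) = g i.
Proof. by rewrite /monev mdomU big_seq_fset1 cmUU expr1. Qed.

Definition xeval (a : nat -> F) : polyx -> F := mmap idfun (monev a).

HB.instance Definition _ a := GRing.RMorphism.on (xeval a).

Lemma xsubstE (g : nat -> polyx) f : xsubst g f = mmap (@malgC {cmonom nat} F) (monev g) f.
Proof. by []. Qed.

HB.instance Definition _ (g : nat -> polyx) := GRing.RMorphism.copy (xsubst g) (mmap (@malgC {cmonom nat} F) (monev g)).

HB.instance Definition _ i := GRing.RMorphism.copy (@xswap F i) (xsubst (fun j => xvar F (adj i j))).

Lemma xevalC a c : xeval a c%:MP = c.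
Proof. exact: mmapC. Qed.
Lemma xevalX a i : xeval a (xvar F i) = a i.
Proof. by rewrite /xeval mmapU /= mul1r monevU. Qed.
Lemma xsubstC (g : nat -> polyx) c : xsubst g c%:MP = c%:MP.
Proof. by rewrite xsubstE mmapC. Qed.
Lemma xsubstX (g : nat -> polyx) i : xsubst g (xvar F i) = g i.
Proof. by rewrite xsubstE mmapU /= mpolyC1E mul1r monevU. Qed.
Lemma xswapC i c : xswap i (c%:MP : polyx) = c%:MP.
Proof. exact: xsubstC. Qed.
Lemma xswapX i j : xswap i (xvar F j) = xvar F (adj i j).
Proof. exact: xsubstX. Qed.
Lemma xeval_ext a a' f : a =1 a' -> xeval a f = xeval a' f.
Proof.
move=> e; rewrite /xeval !mmapE; apply: eq_bigr => m _; congr (_ * _).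
by apply: eq_bigr => j _; rewrite e.
Qed.

Lemma xeval_xsubst a (g : nat -> polyx) f : xeval a (xsubst g f) = xeval (fun j => xeval a (g j)) f.
Proof.
rewrite xsubstE mmapE rmorph_sum [RHS]mmapE; apply: eq_bigr => m _.
rewrite rmorphM /= xevalC; congr (_ * _); rewrite /monev rmorph_prod.
by apply: eq_bigr => j _; rewrite rmorphXn.
Qed.

Lemma xeval_xswap a i f : xeval a (xswap i f) = xeval (a \o adj i) f.
Proof. by rewrite /xswap xeval_xsubst; apply: xeval_ext => j; rewrite xevalX. Qed.

Lemma malgUM (m1 m2 : {cmonom nat}) : (<< mmul m1 m2 >> : polyx) = << m1 >> * << m2 >>.
Proof. by rewrite malgM_def fgmulUU mulr1. Qed.

Lemma monev_xvar m : monev (xvar F) m = << m >>.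
Proof.
move: {2}(mdeg m) (erefl (mdeg m)) => d; elim: d m => [|d IH] m dm.
  by rewrite (mdeg_eq0I dm) mmorph1.
have /fset0Pn [i im] : finsupp m != fset0%fset.
  by apply/eqP => e; move: dm; rewrite mdegE e big_seq_fset0.
have em : m = mmul (ucm i) (divcm m (ucm i)).
  apply/eqP/cmP => j; rewrite cmM divcmE cmU.
  by case: eqP => [<-|_] /=; rewrite ?subn0 // addnC subnK // lt0n cmE_neq0.
have dm' : mdeg (divcm m (ucm i)) = d by move: dm; rewrite {1}em mdegM mdegU => -[].
rewrite em; set q := divcm _ _ in dm' *; rewrite (monev_mmorphism _).1 malgUM monevU; congr (_ * _); exact: IH.
Qed.

Lemma xsubst_id f : xsubst (xvar F) f = f.
Proof.
rewrite xsubstE mmapE [RHS]monalgE; apply: eq_bigr => m _.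
by rewrite monev_xvar malgM_def fgmulUU mulr1 mul1m.
Qed.

Lemma xsubst_comp (g h : nat -> polyx) f : xsubst g (xsubst h f) = xsubst (fun j => xsubst g (h j)) f.
Proof.
rewrite (xsubstE h) mmapE rmorph_sum [RHS]xsubstE mmapE; apply: eq_bigr => m _.
rewrite rmorphM /= xsubstC; congr (_ * _); rewrite /monev rmorph_prod.
by apply: eq_bigr => j _; rewrite rmorphXn.
Qed.

Lemma xsubst_ext (g h : nat -> polyx) f : g =1 h -> xsubst g f = xsubst h f.
Proof.
by move=> e; apply: eq_bigr => m _; exact: (congr1 (fun z => (f@_m)%:MP * z) (monev_ext m e)).
Qed.

Lemma xswapK i : involutive (@xswap F i).
Proof.
move=> f; rewrite /xswap xsubst_comp -[RHS]xsubst_id; apply: xsubst_ext => j.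
by rewrite xsubstX adjK.
Qed.

Lemma xvar_inj : injective (xvar F).
Proof. exact: malgX_inj. Qed.

Lemma xvarB_neq0 i : xvar F i - xvar F i.+1 != 0.
Proof. by rewrite subr_eq0 (inj_eq xvar_inj) neq_ltn ltnSn. Qed.

End Evaluation.

(** * Families of Grothendieck polynomials *)

(* The polynomial ring enters only through its constants, variables, variable swaps and evaluations. *)
Section Model.
Variables (F : fieldType) (b : F) (P : idomainType) (cst : {rmorphism F -> P}) (X : nat -> P).
Variables (sw : nat -> {rmorphism P -> P}) (ev : (nat -> F) -> {rmorphism P -> F}).
Hypothesis XB_neq0 : forall i, X i - X i.+1 != 0.
Hypothesis swC : forall i c, sw i (cst c) = cst c.
Hypothesis swX : forall i j, sw i (X j) = X (adj i j).
Hypothesis swK : forall i, involutive (sw i).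
Hypothesis evC : forall a c, ev a (cst c) = c.
Hypothesis evX : forall a j, ev a (X j) = a j.
Hypothesis evsw : forall a i f, ev a (sw i f) = ev (a \o adj i) f.
Hypothesis ev_ext : forall a a' f, a =1 a' -> ev a f = ev a' f.
Implicit Types (f g h : P) (a : nat -> F) (G : Sinf -> P).

Definition demazure i f g : Prop :=
  (X i - X i.+1) * g = (1 + cst b * X i.+1) * f - (1 + cst b * X i) * sw i f.

Lemma demazure_inj i f g h : demazure i f g -> demazure i f h -> g = h.
Proof. by move=> eg eh; apply: (mulfI (XB_neq0 i)); rewrite eg eh. Qed.

Lemma demazure_lin i c d f f' g g' : demazure i f g -> demazure i f' g' ->
  demazure i (cst c * f + cst d * f') (cst c * g + cst d * g').
Proof.
rewrite /demazure !(rmorphD, rmorphM) /= !swC => e e'.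
rewrite mulrDr ![(X i - _) * (cst _ * _)]mulrCA e e'; ring.
Qed.

Lemma demazureZ i c f g : demazure i f g -> demazure i (cst c * f) (cst c * g).
Proof.
rewrite /demazure !(rmorphD, rmorphM) /= !swC => e.
by rewrite mulrCA e; ring.
Qed.

Lemma demazure_sym i f g : demazure i f g -> sw i g = g.
Proof.
rewrite /demazure => e; apply: (mulfI (XB_neq0 i)); rewrite [RHS]e; have := congr1 (sw i) e.
rewrite !(rmorphM, rmorphB, rmorphD, rmorph1) /= !swX swC swK adj_l adj_r => e'.
by rewrite -opprB mulNr e' opprB.
Qed.

(** The relation pi_i pi_i = -b pi_i: the image of pi_i is symmetric in x_i, x_(i+1), and pi_i
    multiplies symmetric elements by -b. *)
Lemma demazure_sq i f g : demazure i f g -> demazure i g (cst (- b) * g).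
Proof. by move/demazure_sym => e; rewrite /demazure e rmorphN /=; ring. Qed.

Lemma demazure_ev i f g a : demazure i f g ->
  (a i - a i.+1) * ev a g = (1 + b * a i.+1) * ev a f - (1 + b * a i) * ev (a \o adj i) f.
Proof.
move/(congr1 (ev a)).
by rewrite !(rmorphM, rmorphB, rmorphD, rmorph1) /= !evX evC evsw.
Qed.

Definition xom r c : P := cst ((1 + b * c)^-1) * (X r - cst c).

Lemma sw_xom i r c : sw i (xom r c) = xom (adj i r) c.
Proof. by rewrite /xom rmorphM rmorphB /= !swC swX. Qed.

Lemma cst_mulfV (c : F) : c != 0 -> cst c * cst c^-1 = 1.
Proof. by move=> c0; rewrite -rmorphM mulfV // rmorph1. Qed.

(** This is pi_i (x_i ⊖ c) = 1, extended by linearity over symmetric elements. *)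
Lemma demazure_factor i c h : 1 + b * c != 0 -> sw i h = h -> demazure i (xom i c * h) h.
Proof.
move=> c0 sh; rewrite /demazure rmorphM /= sh sw_xom adj_l /xom.
have := cst_mulfV c0; set r := cst _^-1; rewrite rmorphD rmorph1 rmorphM => e.
transitivity (((1 + cst b * cst c) * r) * ((X i - X i.+1) * h)); first by rewrite e mul1r.
ring.
Qed.

Definition xrow r a m : P := \prod_(c < m) xom r (a c).

Lemma sw_xrow i r a m : sw i (xrow r a m) = xrow (adj i r) a m.
Proof. by rewrite /xrow rmorph_prod; apply: eq_bigr => c _; apply: sw_xom. Qed.

Lemma xrowS r a m : xrow r a m.+1 = xrow r a m * xom r (a m).
Proof. by rewrite /xrow big_ord_recr. Qed.

(** For these m, either both or none of a_i, a_(i+1) occur among the first m parameters. *)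
Lemma xrow_adj r a i m : m != i.+1 -> xrow r (a \o adj i) m = xrow r a m.
Proof.
case: (ltnP m i.+1) => [lt _|].
  by apply: eq_bigr => c _ /=; rewrite adj_out //; have := ltn_ord c; rewrite neq_ltn; lia.
rewrite leq_eqVlt eq_sym => /orP[/eqP->|]; first by rewrite eqxx.
elim: m => // m IH; rewrite ltnS leq_eqVlt => /orP[/eqP <- _|lt _].
  rewrite !xrowS /= adj_l adj_r.
  rewrite [LHS]mulrAC; congr (_ * _ * _).
  by apply: eq_bigr => c _ /=; rewrite adj_out //; have := ltn_ord c; rewrite neq_ltn; lia.
rewrite !xrowS /= IH ?adj_out //; first by rewrite neq_ltn; lia.
- by rewrite neq_ltn lt orbT.
- by rewrite neq_ltn; lia.
Qed.

(* The polynomial of a dominant permutation with code lam. *)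
Definition dominant n a (lam : nat -> nat) : P := \prod_(r < n) xrow r a (lam r).

Definition drop_box p (lam : nat -> nat) r := if r == p then (lam p).-1 else lam r.

Lemma dominant_drop n a lam p : (p < n)%N -> (0 < lam p)%N ->
  dominant n a lam = xom p (a (lam p).-1) * dominant n a (drop_box p lam).
Proof.
move=> pn lp; rewrite /dominant (bigD1 (Ordinal pn)) //= [in RHS](bigD1 (Ordinal pn)) //=.
have -> : drop_box p lam p = (lam p).-1 by rewrite /drop_box eqxx.
rewrite -{1}(prednK lp) xrowS [RHS]mulrA; congr (_ * _); first exact: mulrC.
by apply: eq_bigr => r; rewrite /drop_box -val_eqE /= => /negPf->.
Qed.

Lemma sw_dominant n a lam p : (p.+1 < n)%N -> lam p = lam p.+1 ->
  sw p (dominant n a lam) = dominant n a lam.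
Proof.
move=> pn e; pose I0 := Ordinal (ltnW pn); pose I1 := Ordinal pn.
have te (x : 'I_n) : tperm I0 I1 x = adj p x :> nat by exact: tperm_adj.
rewrite /dominant rmorph_prod [RHS](reindex_inj (@perm_inj _ (tperm I0 I1))).
apply: eq_bigr => r _; rewrite te [LHS]sw_xrow; congr (xrow _ _ _).
by rewrite /adj; case: eqP => [->|_] //; case: eqP => [->|].
Qed.

Record groth_family a G : Prop := {
  fam_longest : forall n, G (embed (longest n)) = dominant n a (fun r => n - r.+1)%N;
  fam_demazure : forall (z : Sinf) i, (z i.+1 < z i)%N -> demazure i (G z) (G (mulsr z i)) }.

Definition good a : Prop := injective a /\ forall j, 1 + b * a j != 0.

Lemma good_adj a i : good a -> good (a \o adj i).
Proof. by case=> ai a0; split=> [|j]; [apply: inj_comp (@adj_inj i) | apply: a0]. Qed.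

(** Once the last box of row p is split off as the factor x_p ⊖ a_(lam p - 1), rows p and p+1 have
    equal length, so the rest is symmetric and pi_p deletes the factor. *)
Lemma dominant_step a G n lam p (z : Sinf) : good a -> groth_family a G -> (p.+1 < n)%N ->
  lam p = (lam p.+1).+1 -> (z p.+1 < z p)%N -> G z = dominant n a lam ->
  G (mulsr z p) = dominant n a (drop_box p lam).
Proof.
move=> [_ a0] fam pn el dz eG; apply: demazure_inj (fam_demazure fam dz) _.
rewrite eG (dominant_drop a (ltnW pn)) ?el //=; apply: demazure_factor; first exact: a0.
apply: sw_dominant => //.
by rewrite /drop_box eqxx el; case: eqP => // /eqP; rewrite eqn_leq ltnn.
Qed.

Section LeftFamily.
Variables (a : nat -> F) (G : Sinf -> P) (i : nat).
Hypotheses (ga : good a) (fam : groth_family a G).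

(** The expected effect on G z of the left divided difference in the parameters: it passes to s_i z
    at a left descent, and is multiplication by -b elsewhere, as for a Demazure operator on its own
    image. *)
Definition left_op z : P := if ldes i z then G (mulsl z i) else cst (- b) * G z.

(** Left and right multiplication commute, which settles every case except z s_j = s_i z; there the
    claim becomes pi_j pi_j = -b pi_j. *)
Lemma demazure_left_op j (z : Sinf) : (z j.+1 < z j)%N -> demazure j (left_op z) (left_op (mulsr z j)).
Proof.
move=> dz; have [/andP[/eqP e1 /eqP e2]|nz] := boolP ((z j == i.+1) && (z j.+1 == i)).
  have e : mulsl z i = mulsr z j.
    apply: sinf_ext => l; rewrite mulslE mulsrE.
    case: (eqVneq l j) => [->|nl]; first by rewrite e1 adj_l adj_r e2.
    case: (eqVneq l j.+1) => [->|nl']; first by rewrite e2 adj_l adj_r e1.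
    by rewrite (adj_out nl nl') adj_out // -?e1 -?e2 (inj_eq (@sinf_inj z)).
  rewrite /left_op -e ldes_mulsl.
  have -> : ldes i z by rewrite /ldes (sinv_eq e1) (sinv_eq e2).
  by rewrite e; apply: (@demazure_sq _ (G z)); apply: (fam_demazure fam).
rewrite /left_op (ldes_mulsr dz nz); case: ifP => _; last exact/demazureZ/(fam_demazure fam).
rewrite -mulslr; apply: (fam_demazure fam); rewrite !mulslE; apply: adj_lt => //.
by rewrite andbC.
Qed.

(* Solving the left divided difference for its swapped term expresses the family with parameters *)
(* a o s_i through the family with parameters a. *)
Definition left_family z : P :=
  cst ((1 + b * a i.+1)^-1 * (1 + b * a i)) * G z + cst (- ((1 + b * a i.+1)^-1 * (a i.+1 - a i))) * left_op z.

Lemma left_family_asc z : ~~ ldes i z -> left_family z = G z.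
Proof.
move=> nl; have e : (1 + b * a i.+1)^-1 * (1 + b * a i) + - ((1 + b * a i.+1)^-1 * (a i.+1 - a i)) * - b = 1.
  by field; case: ga.
by rewrite /left_family /left_op (negPf nl) mulrA -rmorphM -mulrDl -rmorphD /= e rmorph1 mul1r.
Qed.

Lemma left_family_eq z : ldes i z ->
  cst (1 + b * a i) * G z = cst (1 + b * a i.+1) * left_family z + cst (a i.+1 - a i) * left_family (mulsl z i).
Proof.
move=> l; have e : left_family (mulsl z i) = G (mulsl z i) by apply: left_family_asc; rewrite ldes_mulsl l.
rewrite e /left_family /left_op l mulrDr !mulrA -!rmorphM mulrN mulrA mulfV; last by case: ga.
by rewrite mulrA mulfV ?mul1r; [rewrite rmorphN mulNr -addrA addNr addr0 | case: ga].
Qed.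

Lemma left_familyP : groth_family (a \o adj i) left_family.
Proof.
split=> [n|z j dz]; last by apply: demazure_lin; [exact: (fam_demazure fam) | exact: demazure_left_op].
case: (ltnP i.+1 n) => [lt|ge]; last first.
  rewrite left_family_asc; last first.
    rewrite ldesN (@sinv_embed_out _ _ i.+1) //; case: (ltnP i n) => [lt|ge'].
      by rewrite (sinv_embed _ (Ordinal lt)); apply: leq_trans ge.
    by rewrite sinv_embed_out.
  rewrite (fam_longest fam); apply: eq_bigr => r _; rewrite xrow_adj //.
  by rewrite neq_ltn; have := ltn_ord r; lia.
(* Row [r0] is the row of length i+1, the only one containing a_i without a_(i+1). Correspondingly
   s_i w = w s_r0 for the longest w. *)
have lt0 := ltnW lt; pose r0 := (n - i.+2)%N.
pose lam r := (n - r.+1)%N.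
have r0n : (r0.+1 < n)%N by rewrite /r0; lia.
have l0 : lam r0 = i.+1 by rewrite /lam /r0; lia.
have l1 : lam r0.+1 = i by rewrite /lam /r0; lia.
set w := embed (longest n).
have wE j : (j < n)%N -> w j = (n - j.+1)%N by move=> jn; rewrite /w (embedE _ (Ordinal jn)) longestE.
have w0 : w r0 = i.+1 by rewrite wE /r0; lia.
have w1 : w r0.+1 = i by rewrite wE /r0; lia.
have dw : (w r0.+1 < w r0)%N by rewrite w0 w1.
have lw : ldes i w by rewrite /ldes (sinv_eq w0) (sinv_eq w1).
have ew : mulsl w i = mulsr w r0.
  apply: sinf_ext => l; rewrite mulslE mulsrE.
  case: (eqVneq l r0) => [->|nl]; first by rewrite w0 adj_l adj_r w1.
  case: (eqVneq l r0.+1) => [->|nl']; first by rewrite w1 adj_l adj_r w0.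
  by rewrite (adj_out nl nl') adj_out // -?w0 -?w1 (inj_eq (@sinf_inj w)).
have st := dominant_step ga fam r0n (etrans l0 (congr1 succn (esym l1))) dw (fam_longest fam n).
rewrite -/w /left_family /left_op lw ew st (fam_longest fam).
have drop a' : dominant n a' lam = xom r0 (a' i) * dominant n a' (drop_box r0 lam).
  by rewrite (dominant_drop a' (ltnW r0n)) l0.
rewrite -/lam !drop.
(* After the last box of row [r0] is removed no row has length i+1, and the claim is left with a
   single linear factor. *)
have -> : dominant n (a \o adj i) (drop_box r0 lam) = dominant n a (drop_box r0 lam).
  apply: eq_bigr => r _; apply: xrow_adj; rewrite /drop_box.
  case: (eqVneq (r : nat) r0) => [_|nr]; first by rewrite l0 /= neq_ltn ltnSn.
  apply: contraNneq nr => e; apply/eqP; have := ltn_ord r; move: e; rewrite /lam /r0; lia.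
rewrite mulrA -mulrDl /comp adj_l; congr (_ * _).
have [_ a0] := ga; rewrite /xom mulrA -rmorphM -mulrA mulfV // mulr1.
by rewrite rmorphN rmorphM rmorphB; ring.
Qed.

End LeftFamily.

Lemma family_sid a G : groth_family a G -> G sid = 1.
Proof. by move=> fam; rewrite -(embed1 0) (_ : 1%g = longest 0) ?(fam_longest fam) ?/dominant ?big_ord0 //; apply/permP; case. Qed.

(* Comparing lengths instead of the Bruhat order is enough for the values at x = a. *)
Lemma family_vanish a G n (z v : 'S_n) : good a -> groth_family a G ->
  (inversions n (embed v) < inversions n (embed z))%N -> ev (a \o embed v) (G (embed z)) = 0.
Proof.
(* Start of a descending induction: unless w is the longest element, some w x < [rev_ord x], and the
   factor of the product with variable x and parameter a_(w x) evaluates to 0. *)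
move=> ga fam; have top (w : 'S_n) : (inversions n (embed w) < inversions n (embed (longest n)))%N ->
    ev (a \o embed w) (G (embed (longest n))) = 0.
  rewrite (fam_longest fam) /dominant rmorph_prod => lt.
  have [/forallP h|] := boolP [forall x : 'I_n, (rev_ord x <= w x)%N].
    by move: lt; rewrite (perm_ge_rev h) ltnn.
  rewrite negb_forall => /existsP[x]; rewrite -ltnNge => wx.
  rewrite (bigD1 x) //= /xrow rmorph_prod (bigD1 (Ordinal wx)) //=.
  by rewrite /xom rmorphM rmorphB /= !evC evX /= embedE subrr mulr0 !mul0r.
move: {2}(n * n - inversions n (embed z))%N (leqnn (n * n - inversions n (embed z))) => d.
elim: d z v => [|d IH] z v le lt; (have [ez|/perm_ascent_ex[i [i' [ii' az]]]] := eqVneq z (longest n); first by rewrite ez in lt *; apply: top).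
  have in1 : (i.+1 < n)%N by rewrite -ii'.
  have := inversions_le n (embed z \o adj i); rewrite inversions_adj ?embedE -?ii' ?embedE //; lia.
have in1 : (i.+1 < n)%N by rewrite -ii'.
pose z' := (tperm i i' * z)%g.
have az' : (embed z i < embed z i.+1)%N by rewrite -ii' !embedE.
have ez' : inversions n (embed z') = (inversions n (embed z)).+1.
  by rewrite -(inversions_adj in1 az'); apply: inversions_ext => x _; rewrite (embed_mulsr ii') mulsrE.
pose v' := (tperm i i' * v)%g.
have ev' : (inversions n (embed v') <= (inversions n (embed v)).+1)%N.
  rewrite (@inversions_ext n _ (embed v \o adj i)) => [|x _]; last by rewrite (embed_mulsr ii') mulsrE.
  by apply: inversions_adj_le => //; rewrite -ii' !embedE (perm_neq v ii').
have dz : demazure i (G (embed z')) (G (embed z)).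
  have -> : embed z = mulsr (embed z') i by rewrite (embed_mulsr ii') mulsrK.
  by apply: (fam_demazure fam); rewrite (embed_mulsr ii') !mulsrE adj_l adj_r.
have := demazure_ev (a \o embed v) dz.
rewrite (IH z' v) ?ez'; [|lia|lia].
rewrite (@ev_ext ((a \o embed v) \o adj i) (a \o embed v')); last by move=> x; rewrite /comp /v' (embed_mulsr ii') mulsrE.
rewrite (IH z' v') ?ez'; [|lia|lia].
rewrite !mulr0 subr0 => /eqP; rewrite mulf_eq0 subr_eq0 => /orP[/eqP /= e|/eqP //].
case: ga => ai _; have := ai _ _ e; move/(@sinf_inj (embed v)) => e'.
by have := ltnSn i; rewrite {1}e' ltnn.
Qed.

Lemma family_delta a G (z : Sinf) : good a -> groth_family a G -> ev a (G z) = (z == sid)%:R.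
Proof.
move=> ga fam; have [->|nz] := eqVneq z sid; first by rewrite (family_sid fam) rmorph1.
have [N hN] := sinf_embed z; have [p ep] := hN N (leqnn N).
rewrite (@ev_ext _ (a \o embed (1%g : 'S_N))); last by move=> x; rewrite /comp embed1 sidE.
rewrite ep; apply: (family_vanish ga fam); rewrite embed1 inversions_sid.
by apply: inversions_embed_gt0; apply: contraNneq nz => p1; rewrite ep p1 embed1.
Qed.

Lemma dominant_ext n a lam lam' : (forall r, (r < n)%N -> lam r = lam' r) -> dominant n a lam = dominant n a lam'.
Proof. by move=> e; apply: eq_bigr => r _; rewrite e. Qed.

Section MaximalSeparated.
Variables (n k : nat).
Hypothesis kn : (k < n)%N.

(* One-line notations met when the last n - k entries of the longest element are sorted by moving *)
(* successively their maxima to the end, and the corresponding codes. *)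
Definition sorting_word m p x : nat :=
  (if x < k then n - x.+1 else if n <= x then x else
  if x - k < p then m - (x - k).+1 else if x - k == p then m
  else if x - k <= m then m - (x - k) else x - k)%N.

Definition sorting_code m p x : nat :=
  (if x < k then n - x.+1 else if x - k < p then m - (x - k).+1 else m - (x - k))%N.

Local Ltac split_lia := rewrite /sorting_word /sorting_code; repeat (rewrite ?ltn0; case: ifP => ?); rewrite ?ltn0; lia.

(** Outer induction with m decreasing from n - k - 1, inner with p increasing. Passing from p to p+1
    multiplies by s_(k+p) at a descent and drops one box; stage (m, 0) has the same word as stage
    (m+1, m+1), or is the longest element. *)
Lemma sorting_code_dominant a G m p (z : Sinf) : good a -> groth_family a G -> (m < n - k)%N -> (p <= m)%N ->
  z =1 sorting_word m p -> G z = dominant n a (sorting_code m p).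
Proof.
move=> ga fam; move: {2}(n - k - m)%N (leqnn (n - k - m)) => d.
elim: d m p z => [|d IHd] m p z; first by lia.
move=> le mN; elim: p z => [|p IHp] z pm ez.
  have [em|nm] := eqVneq m.+1 (n - k)%N.
    have -> : z = embed (longest n).
      apply: sinf_ext => x; rewrite ez; case: (ltnP x n) => xn; last by rewrite embed_out //; split_lia.
      by rewrite (embedE _ (Ordinal xn)) longestE /=; split_lia.
    by rewrite (fam_longest fam); apply: dominant_ext => r rn; split_lia.
  rewrite (IHd m.+1 m.+1 z); [|lia|lia|by []|].
    by apply: dominant_ext => r rn; split_lia.
  by move=> x; rewrite ez; split_lia.
have kp : ((k + p).+1 < n)%N by lia.
pose z0 := mulsr z (k + p).
have ez0 : z0 =1 sorting_word m p.
  move=> x; rewrite mulsrE ez /adj; case: (eqVneq x (k + p)%N) => [->|n1]; first by split_lia.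
  by case: (eqVneq x (k + p).+1) => [->|n2]; split_lia.
have e0 := IHp z0 (ltnW pm) ez0.
have c0 : sorting_code m p (k + p) = (sorting_code m p (k + p).+1).+1 by split_lia.
have dz : (z0 (k + p).+1 < z0 (k + p)%N)%N by rewrite !ez0; split_lia.
have := dominant_step ga fam kp c0 dz e0; rewrite mulsrK => ->.
by apply: dominant_ext => r rn; rewrite /drop_box; split_lia.
Qed.

Lemma maximal_separated_dominant a G (z : Sinf) : good a -> groth_family a G ->
  (forall x, z x = if x < k then n - x.+1 else if x < n then x - k else x)%N ->
  G z = dominant n a (fun r => if r < k then n - r.+1 else 0)%N.
Proof.
move=> ga fam ez; rewrite (@sorting_code_dominant a G 0 0 z) //; last 2 first.
- by rewrite subn_gt0.
- by move=> x; rewrite ez; split_lia.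
Qed.

End MaximalSeparated.

(* For a suitable reduced word s of w this extracts the coefficient of G w; on families it is dual *)
(* to the left divided differences, and the empty word evaluates at x = a. *)
Fixpoint coefD (s : seq nat) f a : F :=
  if s is i :: s' then
    (1 + b * a i) * (coefD s' f a - coefD s' f (a \o adj i)) / (a i - a i.+1)
  else ev a f.

Lemma coefD_lin s c d f g a : coefD s (cst c * f + cst d * g) a = c * coefD s f a + d * coefD s g a.
Proof.
elim: s a => [|i s IH] a /=; first by rewrite rmorphD !rmorphM /= !evC.
by rewrite !IH; ring.
Qed.

Lemma coefDZ s c f a : coefD s (cst c * f) a = c * coefD s f a.
Proof.
by rewrite -[RHS]addr0 -(mul0r (coefD s f a)) -coefD_lin rmorph0 mul0r addr0.
Qed.

Lemma coefDD s f g a : coefD s (f + g) a = coefD s f a + coefD s g a.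
Proof. by have := coefD_lin s 1 1 f g a; rewrite rmorph1 !mul1r. Qed.

Lemma coefD0 s a : coefD s 0 a = 0.
Proof. by have := coefDZ s 0 0 a; rewrite rmorph0 !mul0r. Qed.

Lemma coefD_sum (I : Type) (r : seq I) (f : I -> P) s a :
  coefD s (\sum_(i <- r) f i) a = \sum_(i <- r) coefD s (f i) a.
Proof. by elim: r => [|i r IH]; rewrite ?big_nil ?coefD0 // !big_cons coefDD IH. Qed.

Section Separated.
Variables (n k : nat) (kn : (k <= n)%N).
Implicit Types (u v w : 'S_n) (t y : nat -> F).

Definition sep_left u : Prop := forall x z : 'I_n, (k <= x)%N -> (x < z)%N -> (u x < u z)%N.
Definition sep_right v : Prop := forall x z : 'I_n, (x < z)%N -> (z < k)%N -> (v x < v z)%N.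

(** The two halves say that [coefD s] extracts the coefficient of G_w and that on the product it
    gives the puzzle sum. Parameters, families, u and v are quantified inside, since the induction
    step applies the statement to t o s_i, [left_family] and s_i v. *)
Definition coef_word s w : Prop :=
  (forall a G z, good a -> groth_family a G -> coefD s (G z) a = (z == embed w)%:R) /\
  (forall t y Gt Gy u v, good t -> good y -> groth_family t Gt -> groth_family y Gy -> sep_left u -> sep_right v ->
     coefD s (Gy (embed u) * Gt (embed v)) t = puzzle_Z b k t y u v w).

Section Step.
Variables (i i' : 'I_n) (ii' : i' = i.+1 :> nat).

(** If the value i stood before position k, so would i+1, which precedes it, and v would decrease
    where it must increase. *)
Lemma sep_right_sl v : sep_right v -> ((v^-1)%g i' < (v^-1)%g i)%N -> 
  (k <= (v^-1)%g i)%N /\ sep_right (sl i i' v).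
Proof.
move=> sv dv; split.
  rewrite leqNgt; apply/negP => lt; have := sv _ _ dv lt.
  by rewrite !permKV ii' ltnNge leqnSn.
move=> x z xz zk; rewrite !permM !(tperm_adj ii'); apply: adj_lt; first exact: sv.
apply/negP => /andP[/eqP ex /eqP ez]; move: dv.
have -> : (v^-1)%g i = x by apply: (@perm_inj _ v); rewrite permKV; apply: val_inj.
have -> : (v^-1)%g i' = z by apply: (@perm_inj _ v); rewrite permKV; apply: val_inj; rewrite /= ez ii'.
by rewrite ltnNge ltnW.
Qed.

Lemma sep_left_sl u : sep_left u -> ((u^-1)%g i < k)%N -> sep_left (sl i i' u).
Proof.
move=> su uk x z kx xz; rewrite !permM !(tperm_adj ii'); apply: adj_lt; first exact: su.
apply/negP => /andP[/eqP ex /eqP ez]; move: uk.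
have -> : (u^-1)%g i = x by apply: (@perm_inj _ u); rewrite permKV; apply: val_inj.
by rewrite ltnNge kx.
Qed.

Lemma good_diff a : good a -> a i.+1 - a i != 0.
Proof. by case=> ai _; rewrite subr_eq0 (inj_eq ai) neq_ltn ltnSn orbT. Qed.

(** Without a left descent at i the polynomial is the same for t and t o s_i. At a left descent
    [coefD s] is applied to [left_family_eq] at t o s_i: in the first half only z = s_i w survives,
    in the second the result is compared with the column recurrences. *)
Lemma coef_word_step s w : ((w^-1)%g i < (w^-1)%g i')%N -> coef_word s w -> coef_word (val i :: s) (sl i i' w).
Proof.
move=> aw [del puz]; split.
- move=> a G z ga fam; have ga' := good_adj i ga; have fam' := left_familyP i ga fam.
  have ew : (z == embed (sl i i' w)) = (mulsl z i == embed w).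
    by rewrite (embed_mulsl ii'); apply/eqP/eqP => [->|<-]; rewrite mulslK.
  have lw : ~~ ldes i (embed w) by rewrite (ldes_embed ii') -leqNgt ltnW.
  rewrite /= (del a G z ga fam) ew.
  have [lz|lz] := boolP (ldes i z); last first.
    rewrite -(left_family_asc G ga lz) (del _ _ _ ga' fam') subrr mulr0 mul0r.
    by case: eqP => // e; move: lw; rewrite -e ldes_mulsl lz.
  have -> : (z == embed w) = false by apply/eqP => e; move: lw; rewrite -e lz.
  have := congr1 (fun f => coefD s f (a \o adj i)) (left_family_eq G ga lz).
  rewrite /= coefDZ coefD_lin !(del _ _ _ ga' fam').
  have -> : (z == embed w) = false by apply/eqP => e; move: lw; rewrite -e lz.
  rewrite mulr0 add0r sub0r mulrN => ->.
  have d0 := good_diff ga; rewrite -[a i - _]opprB invrN mulrN mulNr opprK.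
  by rewrite mulrAC mulfV // mul1r.
- move=> t y Gt Gy u v gt gy famt famy su sv.
  have gt' := good_adj i gt; have famt' := left_familyP i gt famt.
  have d0 := good_diff gt; have [_ t0] := gt; have [_ y0] := gy.
  have d0' : t i - t i.+1 != 0 by rewrite -opprB oppr_eq0.
  rewrite /= (puz t y Gt Gy) //.
  have [lv|lv] := boolP (ldes i (embed v)); last first.
    rewrite -(left_family_asc Gt gt lv) (puz _ y _ Gy) //.
    have av : ((v^-1)%g i < (v^-1)%g i')%N.
      rewrite (ldes_embed ii') -leqNgt leq_eqVlt in lv; case/orP: lv => // /eqP/val_inj/perm_inj e.
      by move: ii'; rewrite -e => /eqP; rewrite eqn_leq ltnn andbF.
    have := puzzle_Z_col_asc k ii' t u y0 aw av => e.
    apply: (mulIf d0'); rewrite divfK // mulrBr e; ring.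
  have dv := lv; rewrite (ldes_embed ii') in dv.
  have [kv sv'] := sep_right_sl sv dv.
  have := congr1 (fun f => coefD s (Gy (embed u) * f) (t \o adj i)) (left_family_eq Gt gt lv).
  rewrite /= mulrCA coefDZ mulrDr ![Gy _ * (cst _ * _)]mulrCA coefD_lin -(embed_mulsl ii').
  rewrite !(puz _ y (left_family t Gt i) Gy) // => e1.
  have e2 := puzzle_Z_col_desc ii' t u y0 aw dv kv.
  apply: (mulIf d0'); rewrite divfK // mulrBr e1.
  rewrite e2; ring.
Qed.

End Step.

(** The first k positions use up the k largest values, so the increasing tail runs through the n - k
    smallest. *)
Lemma maximal_tail u : (forall x : 'I_n, (x < k)%N -> u x = rev_ord x) -> sep_left u ->
  forall x : 'I_n, (k <= x)%N -> u x = (x - k)%N :> nat.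
Proof.
move=> hu su x kx.
have bound (z : 'I_n) : (k <= z)%N -> (u z < n - k)%N.
  move=> kz; rewrite ltnNge; apply/negP => le.
  have rk : (rev_ord (u z) < k)%N by rewrite /=; have := ltn_ord (u z); lia.
  have := hu _ rk; rewrite rev_ordK => /perm_inj e.
  by move: rk; rewrite e ltnNge kz.
have upper : (u x <= x - k)%N.
  move: {2}(n - x)%N (leqnn (n - x)) => m; elim: m x kx => [|m IH] x kx le; first by have := ltn_ord x; lia.
  case: (ltnP x.+1 n) => [lt|ge]; last by have := bound x kx; lia.
  have /= := IH (Ordinal lt); have /= := su x (Ordinal lt) kx; lia.
have lower : (x - k <= u x)%N.
  move: {upper} x kx => [m ltm] /=; elim: m ltm => [|m IH] ltm km //.
  case: (ltnP m k) => mk; first by have -> : (m.+1 - k = 0)%N by lia.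
  have := IH (ltnW ltm) mk; have /= := su (Ordinal (ltnW ltm)) (Ordinal ltm) mk; lia.
by lia.
Qed.

Lemma maximal_family u y Gy : good y -> groth_family y Gy -> (forall x : 'I_n, (x < k)%N -> u x = rev_ord x) ->
  sep_left u -> Gy (embed u) = dominant n y (fun r => if r < k then n - r.+1 else 0)%N.
Proof.
move=> gy fam hu su; move: kn; rewrite leq_eqVlt => /orP[/eqP ek|lt].
  have -> : u = longest n by apply/permP => x; rewrite longestE hu // ek.
  by rewrite (fam_longest fam); apply: dominant_ext => r rn; rewrite ek rn.
apply: (maximal_separated_dominant lt gy fam) => x; case: (ltnP x n) => xn; last first.
  by rewrite embed_out //; case: ltnP => //; lia.
rewrite (embedE u (Ordinal xn)); case: (ltnP x k) => xk; first by rewrite hu.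
by rewrite (maximal_tail hu su).
Qed.

(** If no such i exists, a value j at a position below k is preceded by j+1, that one by j+2, and so
    on; hence j has at least n - 1 - j positions before it ([low]). So u x >= n - 1 - x, and
    injectivity forces equality from x = 0 upwards. *)
Lemma maximal_or_ascent u : (forall x : 'I_n, (x < k)%N -> u x = rev_ord x) \/
  exists i i' : 'I_n, [/\ i' = i.+1 :> nat, ((u^-1)%g i < (u^-1)%g i')%N & ((u^-1)%g i < k)%N].
Proof.
have [/existsP[i /existsP[i' /and3P[/eqP e l1 l2]]]|h] := boolP [exists i : 'I_n, exists i' : 'I_n,
    [&& i' == i.+1 :> nat, (u^-1)%g i < (u^-1)%g i' & (u^-1)%g i < k]%N]; first by right; exists i, i'.
left; have {}h (i i' : 'I_n) : i' = i.+1 :> nat -> ((u^-1)%g i < k)%N -> ((u^-1)%g i' < (u^-1)%g i)%N.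
  move=> e ik; rewrite ltn_neqAle eq_sym (perm_neq _ e) /= leqNgt; apply/negP => lt.
  case/negP: h; apply/existsP; exists i; apply/existsP; exists i'.
  by rewrite e eqxx lt ik.
have low (j : 'I_n) : ((u^-1)%g j < k)%N -> (n - j.+1 <= (u^-1)%g j)%N.
  move: {2}(n - j)%N (leqnn (n - j)) => m; elim: m j => [|m IH] j le jk; first by have := ltn_ord j; lia.
  case: (ltnP j.+1 n) => [lt|ge]; last by lia.
  have l := h j (Ordinal lt) erefl jk.
  by have /= := IH (Ordinal lt) _ (ltn_trans l jk); move: l => /=; lia.
move=> x; move: {2}(val x) (leqnn x) => m; elim: m x => [|m IH] x le xk.
  apply: val_inj; have := low (u x); rewrite permK => /(_ xk); have := ltn_ord (u x) => /=.
  by move: le; rewrite leqn0 => /eqP -> /=; lia.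
have ge : (n - x.+1 <= u x)%N by have := low (u x); rewrite permK => /(_ xk); have := ltn_ord (u x); lia.
apply: val_inj; apply/eqP; rewrite eqn_leq ge andbT leqNgt; apply/negP => lt.
have lx : (rev_ord (u x) < x)%N by rewrite /=; have := ltn_ord (u x); move: lt => /=; lia.
have l2 : (rev_ord (u x) <= m)%N by rewrite -ltnS; exact: leq_trans lx le.
have e := IH (rev_ord (u x)) l2 (ltn_trans lx xk); rewrite rev_ordK in e.
by move: lx; rewrite (perm_inj e) ltnn.
Qed.

Lemma maximal_eval u t y Gy : good y -> groth_family y Gy -> (forall x : 'I_n, (x < k)%N -> u x = rev_ord x) ->
  sep_left u -> ev t (Gy (embed u)) = puzzle_Z b k t y u 1%g 1%g.
Proof.
move=> gy fam hu su; rewrite (maximal_family gy fam hu su) (puzzle_Z_max hu) /dominant rmorph_prod.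
rewrite [RHS]big_mkcond /=; apply: eq_bigr => r _; rewrite /xrow rmorph_prod.
case: ifP => rk; last by rewrite big_ord0.
rewrite (big_ord_widen _ (fun c => ev t (xom r (y c))) (leq_subr r.+1 n)).
apply: eq_big => [c|c _]; first by have := ltn_ord r; lia.
by rewrite /xom rmorphM rmorphB /= !evC evX mulrC.
Qed.

(** Descending induction on length. If u is not maximal, s_i u is longer and still separated;
    [left_family_eq] at s_i u recovers G_u from its values for y and y o s_i, and
    [puzzle_Z_row_desc] is the same relation for puzzles. *)
Lemma puzzle_Z_base u t y Gy : good t -> good y -> groth_family y Gy -> sep_left u ->
  ev t (Gy (embed u)) = puzzle_Z b k t y u 1%g 1%g.
Proof.
move=> gt; have [_ t0] := gt.
move: {2}(n * n - inversions n (embed (u^-1)%g))%N (leqnn (n * n - inversions n (embed (u^-1)%g))) => d.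
elim: d u y Gy => [|d IH] u y Gy le gy fam su;
  (case: (maximal_or_ascent u) => [hu|[i [i' [ii' au uk]]]]; first exact: maximal_eval).
  have in1 : (i.+1 < n)%N by rewrite -ii'.
  have := inversions_le n (embed (u^-1)%g \o adj i); rewrite inversions_adj ?embedE -?ii' ?embedE //; lia.
have in1 : (i.+1 < n)%N by rewrite -ii'.
pose u1 := sl i i' u; have u1V : (u1^-1 = tperm i i' * u^-1)%g by rewrite /u1 /sl invMg tpermV.
have [_ y0] := gy; have gy' := good_adj i gy; have fam' := left_familyP i gy fam.
have su1 : sep_left u1 by apply: sep_left_sl.
have le1 : (n * n - inversions n (embed (u1^-1)%g) <= d)%N.
  rewrite u1V (@inversions_ext n _ (embed (u^-1)%g \o adj i)) => [|x _]; last by rewrite (embed_mulsr ii') mulsrE.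
  by rewrite inversions_adj ?embedE -?ii' ?embedE //; lia.
have lu : ldes i (embed u1) by rewrite (embed_mulsl ii') ldes_mulsl (ldes_embed ii') -leqNgt ltnW.
have nlu : ~~ ldes i (embed u) by rewrite (ldes_embed ii') -leqNgt ltnW.
have := congr1 (ev t) (left_family_eq Gy gy lu).
rewrite (rmorphD (ev t)) !(rmorphM (ev t)) !evC {2}/u1 (embed_mulsl ii') mulslK (left_family_asc Gy gy nlu) -(embed_mulsl ii').
rewrite (IH u1 y Gy) // (IH u1 _ _ le1 gy' fam') //.
have dV : ((u1^-1)%g i' < (u1^-1)%g i)%N by rewrite !slV tpermL tpermR.
have kV : ((u1^-1)%g i' < k)%N by rewrite slV tpermR.
have := puzzle_Z_row_desc ii' 1%g 1%g t0 y0 dV kV; rewrite {2}/u1 slK (puzzle_Z_row_asc _ ii' 1%g 1%g t0 y0 au) => <-.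
by move/addrI/(mulfI (good_diff i gy)) => <-.
Qed.

(** For v different from 1 both sides vanish, the left by [family_delta] and the right because there
    is no puzzle. *)
Lemma puzzle_Z_id u t y Gt Gy v : good t -> good y -> groth_family t Gt -> groth_family y Gy -> sep_left u -> sep_right v ->
  ev t (Gy (embed u) * Gt (embed v)) = puzzle_Z b k t y u v 1%g.
Proof.
move=> gt gy famt famy su sv; rewrite rmorphM /= (family_delta _ gt famt).
have [->|nv] := eqVneq v 1%g; first by rewrite embed1 eqxx mulr1; apply: puzzle_Z_base.
have -> : (embed v == sid) = false by apply: contraNF nv => /eqP; rewrite -(embed1 n) => /embed_inj->.
rewrite mulr0 /puzzle_Z big_pred0 // => T; apply: contraNF nv => /puzzles_id_empty -> //.
by move=> x z /andP[xz zk]; apply: sv.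
Qed.

Lemma coef_word_exists w : exists s, coef_word s w.
Proof.
(* Left multiplication of w by s_i permutes the positions of its inverse, hence the inversions of
   w^-1 are counted. *)
move: {2}(inversions n (embed (w^-1)%g)) (erefl (inversions n (embed (w^-1)%g))) => d.
elim: d w => [|d IH] w ed.
  have -> : w = 1%g.
    apply: invg_inj; rewrite invg1; apply/eqP; apply: contraTT isT => /inversions_embed_gt0.
    by rewrite ed.
  exists [::]; split=> [a G z ga fam|t y Gt Gy u v]; first by rewrite /= (family_delta _ ga fam) embed1.
  exact: puzzle_Z_id.
have [e1|] := eqVneq (w^-1)%g 1%g; first by move: ed; rewrite e1 embed1 inversions_sid.
case/perm_descent_ex => i [i' [ii' dw]].
have in1 : (i.+1 < n)%N by rewrite -ii'.
pose w0 := sl i i' w; have aw0 : ((w0^-1)%g i < (w0^-1)%g i')%N by rewrite !slV tpermL tpermR.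
have [|s hs] := IH w0; last by exists (val i :: s); rewrite -(slK i i' w); apply: coef_word_step.
apply: succn_inj; rewrite -ed -(@inversions_adj n _ i) //.
  have e : (w^-1 = tperm i i' * w0^-1)%g by rewrite /w0 /sl invMg tpermV mulgA tperm2 mul1g.
  by apply: inversions_ext => x _; rewrite e (embed_mulsr ii') mulsrE.
by rewrite -ii' !embedE.
Qed.

Theorem separated_coefficient t y Gt Gy u v w (c : {fsfun Sinf -> F with 0}) :
  good t -> good y -> groth_family t Gt -> groth_family y Gy -> sep_left u -> sep_right v ->
  Gy (embed u) * Gt (embed v) = \sum_(z <- finsupp c) cst (c z) * Gt z ->
  c (embed w) = puzzle_Z b k t y u v w.
Proof.
move=> gt gy famt famy su sv e; have [s [del puz]] := coef_word_exists w.
rewrite -(puz t y Gt Gy u v) // e coefD_sum.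
under eq_bigr do rewrite coefDZ (del _ _ _ gt famt).
have [wc|wc] := boolP (embed w \in finsupp c).
  rewrite (big_fsetD1 (embed w)) //= eqxx mulr1 big_seq big1 ?addr0 // => z.
  by rewrite in_fsetD1 => /andP[/negPf -> _]; rewrite mulr0.
rewrite fsfun_dflt // big_seq big1 // => z zc; case: eqP => [ez|_]; last by rewrite mulr0.
by move: wc; rewrite -ez zc.
Qed.


End Separated.

End Model.

(** * The polynomial ring as an instance of the model *)

Section Instance.
Variables (F : fieldType) (b : F).
Local Notation polyx := {malg F[{cmonom nat}]}.

Definition xswap_morphism i : {rmorphism polyx -> polyx} := @xswap F i.
Definition xeval_morphism a : {rmorphism polyx -> F} := @xeval F a.
Local Notation cst := (@malgC {cmonom nat} F : {rmorphism F -> polyx}).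

Lemma demazureP i (f g : polyx) : is_demazure b i f g -> demazure b cst (xvar F) xswap_morphism i f g.
Proof.
move=> e; apply: (etrans e).
exact: (f_equal2 (fun u v : polyx => (1 + u) * f - (1 + v) * xswap i f)
  (esym (mul_malgC b (xvar F i.+1))) (esym (mul_malgC b (xvar F i)))).
Qed.

Lemma xominusP r c : xominus b r c = xom b cst (xvar F) r c.
Proof. exact: (esym (mul_malgC _ _)). Qed.

Lemma familyP a G : double_grothendieck b a G -> groth_family b cst (xvar F) xswap_morphism a G.
Proof.
case=> lg dz; split=> [n|z i d]; last exact/demazureP/dz.
rewrite lg; apply: eq_bigr => r _.
apply: (@etrans _ _ (\prod_(c < n - r.+1) xominus b r (a c))); last by apply: eq_bigr => c _; exact: xominusP.
rewrite (big_ord_widen _ (fun c => xominus b r (a c)) (leq_subr r.+1 n)).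
by apply: eq_bigl => c; have := ltn_ord r; lia.
Qed.

End Instance.

(** * Descent conditions, reduction to k at most n, and genericity of the indeterminates *)

Section Descents.
Variables (n k : nat).
Implicit Types (u v : 'S_n).

Lemma mem_descents u (i i' : 'I_n) : i' = i.+1 :> nat -> (u i' < u i)%N -> i.+1 \in descents u.
Proof.
move=> e l; apply/mapP; exists (val i) => //.
by rewrite mem_filter mem_iota /= ltn_ord -e !embedE l.
Qed.

Lemma perm_chain u (x z : 'I_n) : (x < z)%N ->
  (forall i i' : 'I_n, i' = i.+1 :> nat -> (x <= i)%N -> (i' <= z)%N -> (u i < u i')%N) -> (u x < u z)%N.
Proof.
case: z => m ltm /= xm; elim: m ltm xm => // m IH ltm xm asc.
have step := asc (Ordinal (ltnW ltm)) (Ordinal ltm) erefl xm (leqnn _).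
move: xm; rewrite ltnS leq_eqVlt => /orP[/eqP e|lt].
  by apply: leq_ltn_trans step; rewrite (_ : x = Ordinal (ltnW ltm)) //; apply: val_inj.
apply: ltn_trans step; apply: IH => // i i' e xi le; apply: asc => //; exact: leq_trans le (leqnSn m).
Qed.

Lemma maxdes_sep u : (maxdes u <= k)%N -> sep_left k u.
Proof.
move=> hu x z kx xz; apply: perm_chain xz _ => i i' e xi _.
rewrite ltn_neqAle (perm_neq _ e) leqNgt; apply/negP => l.
have := leq_trans (@leq_bigmax_seq _ _ xpredT id _ (mem_descents e l) isT) hu.
by rewrite ltnNge (leq_trans kx xi).
Qed.

(** The list of descents is sorted, so its head bounds every descent from below. *)
Lemma mindes_sep v : leq_oo k (mindes v) -> sep_right k v.
Proof.
move=> hv x z xz zk; apply: perm_chain xz _ => i i' e _ iz.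
rewrite ltn_neqAle (perm_neq _ e) leqNgt; apply/negP => l.
have := mem_descents e l; move: hv; rewrite /mindes.
have : sorted leq (descents v).
  by rewrite sorted_map; apply: (sorted_filter leq_trans); apply: iota_sorted.
case: (descents v) => // d s /= p kd; rewrite inE => /orP[/eqP ei|is_].
  by move: (leq_ltn_trans iz zk); rewrite e ei ltnNge kd.
have := allP (order_path_min leq_trans p) _ is_ => /(leq_trans kd).
by rewrite leqNgt -e (leq_ltn_trans iz zk).
Qed.

(** All positions are below n, so they compare with k as with its truncation at n; this gives access
    to the results stated for k <= n. *)
Lemma pipe_puzzles_min u v (w : 'S_n) : pipe_puzzles k u v w = pipe_puzzles (minn k n) u v w.
Proof.
have r i : right_label k u i = right_label (minn k n) u i.
  by rewrite /right_label leq_min ltn_ord andbT.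
have t j : top_label k v j = top_label (minn k n) v j.
  by rewrite /top_label gtn_min [(n < _)%N]ltnNge ltn_ord orbF.
apply/setP => T; rewrite !inE; congr [&& _, _ & _].
by apply: eq_forallb => i; apply: eq_forallb => j; rewrite r t.
Qed.

Lemma sep_left_min u : sep_left k u -> sep_left (minn k n) u.
Proof.
move=> h x z; rewrite geq_min => /orP[kx|nx]; first exact: h.
by have := ltn_ord x; rewrite ltnNge nx.
Qed.

Lemma sep_right_min v : sep_right k v -> sep_right (minn k n) v.
Proof. by move=> h x z xz zk; apply: h => //; apply: leq_trans zk (geq_minl _ _). Qed.

End Descents.

Lemma indet_inj : injective indet.
Proof. by move=> p q /eqP; rewrite tofrac_eq => /eqP/malgX_inj. Qed.

Lemma add1M_neq0 (R S : nzRingType) (phi : {rmorphism R -> S}) p q : phi p = 0 -> 1 + p * q != 0.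
Proof.
move=> p0; apply/eqP => /(congr1 phi) /eqP.
by rewrite rmorphD rmorphM rmorph1 rmorph0 p0 mul0r addr0 oner_eq0.
Qed.

(** The constant coefficient of this polynomial is 1. *)
Lemma indet_denominator p q : 1 + indet p * indet q != 0.
Proof.
rewrite /indet -tofracM -tofrac1 -tofracD tofrac_eq0.
apply: (@add1M_neq0 _ _ (mcoeff mone : {rmorphism {malg int[{cmonom param}]} -> int})).
by rewrite [LHS]mcoeffU cm1_eq1.
Qed.

Lemma good_tvar : good beta tvar.
Proof. by split=> [i j /indet_inj[]|j] //; apply: indet_denominator. Qed.

Lemma good_yvar : good beta yvar.
Proof. by split=> [i j /indet_inj[]|j] //; apply: indet_denominator. Qed.

Theorem theorem2p5 (n k : nat) (u v w : 'S_n)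
  (hu : (maxdes u <= k)%N) (hv : leq_oo k (mindes v))
  (Gt Gy : Sinf -> {malg coeff[{cmonom nat}]})
  (hGt : double_grothendieck beta tvar Gt)
  (hGy : double_grothendieck beta yvar Gy)
  (c : {fsfun Sinf -> coeff with 0})
  (hc : Gy (embed u) * Gt (embed v) = \sum_(z <- finsupp c) c z *: Gt z) :
  c (embed w) = \sum_(T in pipe_puzzles k u v w) puzzle_weight beta tvar yvar T.
Proof.
have [su sv] := (sep_left_min (maxdes_sep hu), sep_right_min (mindes_sep hv)).
rewrite pipe_puzzles_min.
apply: (@separated_coefficient _ _ _ (@malgC {cmonom nat} coeff) (xvar coeff)
  (@xswap_morphism coeff) (@xeval_morphism coeff) _ _ _ _ _ _ _ _ n (minn k n) (geq_minr k n)
  _ _ _ _ _ _ w c good_tvar good_yvar (familyP hGt) (familyP hGy) su sv).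
- exact: xvarB_neq0.
- exact: xswapC.
- exact: xswapX.
- exact: xswapK.
- exact: xevalC.
- exact: xevalX.
- exact: xeval_xswap.
- exact: xeval_ext.
- apply: (etrans hc); apply: eq_bigr => z _; exact: (esym (mul_malgC _ _)).
Qed.
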